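(* Let $P(x,dy)$ be a probability kernel on a measurable space $(S,\mathcal S)$, let $h:S\to[0,\infty)$ be harmonic with respect to $P$, and let $o\in S$ with $h(o)>0$. On a probability space with probability measure $\mathbb P$, let $\hat X=(\hat X_n)_{n\ge 0}$ be a Markov chain with transition kernel $P^h$ and initial state $\hat X_0=o$, and let $Y$ be a random variable independent of $\hat X$ with values in $(h(o),\infty)$ and distribution given by $$\mathbb P(Y>y)=\frac{h(o)}{y},\qquad y\ge h(o)$$ (so that $Y^{-1}$ is uniformly distributed on $(0,h(o)^{-1})$). Define the random variable $$T:=\sup\{n\ge 0 : h(\hat X_m)<h(\hat X_n)\le Y \text{ for all } m<n\}\in\{0,1,2,\ldots\}\cup\{\infty\}.$$ Moreover, on the event $\{T<\infty\}$ let $\check X=(\check X_n)_{n\ge0}$ be a process starting in $\check X_0=\hat X_T$, whose conditional distribution, given $\hat X$ and $Y$, is equal to that of a Markov chain with transition kernel $P$ (with initial state $\hat X_T$) conditioned to stay inside $\{x\in S: h(x)\le h(\hat X_T)\}$ for all times. Then the process $\bar X=(\bar X_n)_{n\ge0}$ given by $$\bar X_n:=\begin{cases}\hat X_n, & n<T,\\ \check X_{n-T}, & n\ge T,\end{cases}$$ (so that $\bar X_n=\hat X_n$ for all $n$ if $T=\infty$) is a Markov chain with transition kernel $P$ and initial state $o$, that is, $\bar X$ under $\mathbb P$ is equal in distribution to $(X_n)_{n\ge0}$ under the measure $\mathbf P_o$.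
   Context: $(S,\mathcal S)$ is an arbitrary measurable space (no topological restrictions). $X=(X_n)_{n\ge 0}$ denotes a Markov chain with transition kernel $P$, and $\mathbf P_x$ the corresponding probability measure when the initial state is $x$. A function $h:S\to[0,\infty)$ (finite-valued, measurable) is harmonic with respect to $P$ if $h(x)=\int P(x,dy)\,h(y)$ for all $x\in S$. Put $S^h:=\{x\in S: h(x)>0\}$. The $h$-transformed kernel is the probability kernel on $S^h$ given by $P^h(x,dy):=\frac{1}{h(x)}P(x,dy)h(y)$. ''A Markov chain with transition kernel $P$ and initial state $x$ conditioned to stay inside $\{y: h(y)\le s\}$'', where $h(x)\le s$, means the process $(X_n)_{n\ge0}$ under the conditional law $\mathbf P_x(\,\cdot\mid h(X_i)\le s\ \forall i\ge 0)$; here it is used with $x=\hat X_T$ and $s=h(\hat X_T)$. (The conditioning event has strictly positive probability.) *)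

(* Defs.v *)
From HB Require Import structures.
From mathcomp Require Import all_boot all_order all_algebra.
From mathcomp Require Import all_classical all_reals all_analysis.
From mathcomp Require Import measurable_realfun.

Set Implicit Arguments.
Unset Strict Implicit.
Unset Printing Implicit Defensive.
Import Order.TTheory GRing.Theory Num.Theory.
Import numFieldNormedType.Exports.

Local Open Scope classical_set_scope.
Local Open Scope ring_scope.

Definition is_harmonic (R : realType) (d : measure_display) (S : measurableType d)
    (P : R.-pker S ~> S) (h : S -> R) : Prop :=
  [/\ measurable_fun [set: S] h,
      forall x, 0 <= h x
    & forall x, ((h x)%:E = \int[P x]_y (h y)%:E)%E].

(* S^h = {x | h x > 0} with the trace sigma-algebra.  Measurable types of the
   library are pointed; [ho] provides the point [o]. *)
Definition posset (R : realType) (S : Type) (h : S -> R) (o : S)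
  (ho : 0 < h o) : Type := {x : S | 0 < h x}.

Definition posval (R : realType) (S : Type) (h : S -> R) (o : S)
  (ho : 0 < h o) (x : posset ho) : S := sval x.

Definition pospt (R : realType) (S : Type) (h : S -> R) (o : S)
  (ho : 0 < h o) : posset ho := exist (fun x => 0 < h x) o ho.

Section posset_measurable.
Context (R : realType) (d : measure_display) (S : measurableType d).
Variables (h : S -> R) (o : S) (ho : 0 < h o).

HB.instance Definition _ := Choice.copy (posset ho) {x : S | 0 < h x}.
HB.instance Definition _ := isPointed.Build (posset ho) (pospt ho).
HB.instance Definition _ := Measurable.copy (posset ho)
  (g_sigma_algebra_preimageType (@posval R S h o ho)).

Lemma posval_gt0 (x : posset ho) : 0 < h (posval x).
Proof. exact: svalP x. Qed.

Lemma posval_inj : injective (@posval R S h o ho).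
Proof. by move=> [x hx] [y hy] /= xy; exact: eq_exist. Qed.

Lemma measurable_posval : measurable_fun [set: posset ho] (@posval R S h o ho).
Proof. by move=> _ B mB; exists B. Qed.

Lemma measurable_posval_image (A : set (posset ho)) :
  measurable_fun [set: S] h -> measurable A ->
  measurable (@posval _ _ _ _ ho @` A).
Proof.
move=> mh [B mB]; rewrite setTI => <-.
rewrite (_ : _ @` _ = B `&` h @^-1` `]0, +oo[).
  apply: measurableI => //; rewrite -[X in measurable X]setTI; exact: mh.
apply/seteqP; split=> [_ [x /= Bx <-]|x [/= Bx]].
  by split=> //=; rewrite in_itv/= andbT posval_gt0.
rewrite in_itv/= andbT => hx.
by exists (exist _ x hx).
Qed.

End posset_measurable.

(* The kernel P^h(x, dy) = h(x)^-1 P(x, dy) h(y) on S^h. *)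
Section htransform.
Context (R : realType) (d : measure_display) (S : measurableType d).
Variables (P : R.-pker S ~> S) (h : S -> R) (hP : is_harmonic P h).
Variables (o : S) (ho : 0 < h o).
Local Open Scope ereal_scope.

Definition htransform_set of is_harmonic P h :=
  fun (x : posset ho) (A : set (posset ho)) =>
  ((h (posval x))^-1)%:E *
    \int[P (posval x)]_(y in @posval _ _ _ _ ho @` A) (h y)%:E.

Local Notation Ph := (htransform_set hP).
Local Notation val_ := (@posval _ _ _ _ ho).

Let mh : measurable_fun [set: S] h. Proof. by case: hP. Qed.
Let mhE : measurable_fun [set: S] (fun x => (h x)%:E).
Proof. exact/measurable_EFinP. Qed.
Let h0 x : 0 <= (h x)%:E. Proof. by rewrite lee_fin; case: hP. Qed.

Let Ph0 x : Ph x set0 = 0.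
Proof. by rewrite /htransform_set image_set0 integral_set0 mule0. Qed.

Let Ph_ge0 x A : 0 <= Ph x A.
Proof.
apply: mule_ge0; last exact: integral_ge0.
by rewrite lee_fin invr_ge0 ltW// posval_gt0.
Qed.

Let Ph_sigma_additive x : semi_sigma_additive (Ph x).
Proof.
move=> F mF tF mUF.
rewrite [X in _ --> X](_ : _ = \sum_(i <oo) Ph x (F i)); last first.
  rewrite /htransform_set image_bigcup ge0_integral_bigcup//.
  - rewrite nneseriesZl// => i _; exact: integral_ge0.
  - by move=> k; exact: measurable_posval_image.
  - exact: measurable_funTS.
  - apply/trivIsetP => i j _ _ ij; apply/seteqP; split=> // z.
    move=> [[a Fa <-] [b + /posval_inj ba]]; rewrite ba => Fb.
    move/trivIsetP : tF => /(_ i j I I ij) Fij.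
    by have : (F i `&` F j) a by []; rewrite Fij.
by apply: is_cvg_ereal_nneg_natsum_cond => n _ _; exact: Ph_ge0.
Qed.

HB.instance Definition _ x := isMeasure.Build _ _ R (Ph x)
  (Ph0 x) (Ph_ge0 x) (@Ph_sigma_additive x).

Definition htransform (x : posset ho) :
  {measure set (posset ho) -> \bar R} := Ph x.

Let measurable_Ph A : measurable A -> measurable_fun setT (Ph ^~ A).
Proof.
move=> mA; apply: emeasurable_funM.
  apply/measurable_EFinP.
  rewrite (_ : (fun x => _) =
    ((fun r : R => powR r (-1)) \o (h \o val_))); last first.
    by apply/funext => x /=; rewrite powR_inv1// ltW// posval_gt0.
  apply: measurableT_comp; first exact: measurable_powR.
  by apply: measurableT_comp => //; exact: measurable_posval.
under eq_fun do rewrite integral_mkcond.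
apply: (measurableT_comp
  (f := fun x => \int[P x]_y ((fun y => (h y)%:E) \_ (val_ @` A)) y)).
  apply: measurable_fun_integral_kernel.
  - by move=> U mU; exact: measurable_kernel.
  - by move=> z; rewrite patchE; case: ifP.
  - apply/(measurable_restrictT _ _).1; first exact: measurable_posval_image.
    exact: measurable_funTS.
exact: measurable_posval.
Qed.

HB.instance Definition _ := isKernel.Build _ _ (posset ho) (posset ho) R
  htransform measurable_Ph.

Let Ph_setT x : Ph x [set: _] = 1.
Proof.
have -> : Ph x setT = ((h (posval x))^-1)%:E * \int[P (posval x)]_y (h y)%:E.
  rewrite /htransform_set; congr (_ * _).
  rewrite integral_mkcond; apply: eq_integral => y _.
  rewrite patchE; case: ifPn => // /negP yA.
  have := h0 y; rewrite le_eqVlt => /predU1P[//|hy].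
  exfalso; apply: yA; rewrite inE/=.
  by rewrite lte_fin in hy; exists (exist _ y hy).
have [_ _ <-] := hP.
by rewrite -EFinM mulVf// gt_eqF// posval_gt0.
Qed.

HB.instance Definition _ := Kernel_isProbability.Build _ _ (posset ho)
  (posset ho) R htransform Ph_setT.

End htransform.

Arguments htransform {R d S P h} hP {o} ho x.

(* The sigma-algebra generated by the variables X_i, i in I. *)
Definition sigma_process (W : Type) (d : measure_display)
    (S : measurableType d) (I : set nat) (X : nat -> W -> S) : set (set W) :=
  <<s \bigcup_(i in I) preimage_set_system [set: W] (X i) measurable >>.

(* The product sigma-algebra on the space of paths S^nat. *)
Definition path_measurable (d : measure_display) (S : measurableType d) :
    set (set (nat -> S)) :=
  sigma_process [set: nat] (fun n (p : nat -> S) => p n).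

(* The initial condition is expressed through the law of X_0: in an arbitrary
   measurable space the singleton of [x] need not be measurable.  The last
   clause says that K (X_n, A) is a version of the conditional probability of
   {X_(n+1) in A} given X_0, ..., X_n. *)
Definition markov_chain (R : realType)
    (dW : measure_display) (W : measurableType dW) (mu : probability W R)
    (d : measure_display) (S : measurableType d) (K : R.-pker S ~> S) (x : S)
    (X : nat -> W -> S) : Prop :=
  [/\ forall n, measurable_fun [set: W] (X n),
      forall A, measurable A -> mu (X 0%N @^-1` A) = \d_x A
    & forall n D A, sigma_process [set i | (i <= n)%N] X D -> measurable A ->
        (mu (D `&` X n.+1 @^-1` A) = \int[mu]_(w in D) K (X n w) A)%E].

Definition independent_systems (R : realType)
    (dW : measure_display) (W : measurableType dW) (mu : probability W R)
    (F G : set (set W)) : Prop :=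
  forall A B, F A -> G B -> (mu (A `&` B) = mu A * mu B)%E.

(* mu (X in B | h (X_i) <= s for all i) *)
Definition cond_stay (R : realType)
    (dW : measure_display) (W : measurableType dW) (mu : probability W R)
    (S : Type) (X : nat -> W -> S) (h : S -> R) (s : R)
    (B : set (nat -> S)) : \bar R :=
  let stay := [set v | forall i, h (X i v) <= s] in
  (mu ([set v | B (X ^~ v)] `&` stay) / mu stay)%E.

(* On the event E, the process Z has conditional law kappa given F. *)
Definition conditional_law_on (R : realType)
    (dW : measure_display) (W : measurableType dW) (mu : probability W R)
    (d : measure_display) (S : measurableType d)
    (F : set (set W)) (E : set W) (Z : nat -> W -> S)
    (kappa : W -> set (nat -> S) -> \bar R) : Prop :=
  forall D B, F D -> path_measurable B ->
    (mu (D `&` E `&` [set w | B (Z ^~ w)]) =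
     \int[mu]_(w in D `&` E) kappa w B)%E.

(* sup {n | u_m < u_n <= y for all m < n} in the extended reals; it is +oo
   exactly when there are infinitely many such n. *)
Definition last_record (R : realType) (u : nat -> R) (y : R) : \bar R :=
  ereal_sup [set (n%:R)%:E | n in
    [set n | forall m, (m < n)%N -> u m < u n /\ u n <= y]].

(* [time t] is n when t = n%:R; it is only used when t < +oo. *)
Definition time (R : realType) (t : \bar R) : nat := Num.truncn (fine t).

Definition splice (R : realType) (S : Type) (t : \bar R) (p q : nat -> S) :
    nat -> S :=
  fun n => if (n%:R%:E < t)%E then p n else q (n - time t)%N.

(* Main.v *)
Require Import Defs.
From HB Require Import structures.
From mathcomp Require Import all_boot all_order all_algebra.
From mathcomp Require Import all_classical all_reals all_analysis.
From mathcomp Require Import measurable_realfun ring lra.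

Set Implicit Arguments.
Unset Strict Implicit.
Unset Printing Implicit Defensive.
Import Order.TTheory GRing.Theory Num.Theory.
Import numFieldNormedType.Exports.

Local Open Scope classical_set_scope.
Local Open Scope ring_scope.

(** Why the theorem holds.  For a path p, call n a record if h (p m) < h (p n)
    for all m < n.  Write Z for Xhat seen as a process in S, and X for the chain
    with kernel P started in o.

    On events of the first m+1 coordinates the law of Z has the density
    h (X_m) / h o with respect to the law of X ([hchain_density]).  If A is such
    an event and m > 0 is a record on A, then, Y being independent of Z with
    P (Y >= v) = h o / v for v >= h o,
      P (Z in A, h (Z_m) <= Y) = E [h o / h (Z_m); Z in A] = P_o (X in A):
    the tail of Y cancels the density ([record_probability]).  The event T >= n
    says that some record m >= n has a value at most Y; as values increase along
    records it is enough to look at the first record after n.  Summing over the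
    position of that record gives, for A depending on the first n+1 coordinates,
      P (Z in A, T >= n) = P_o (X in A, X has a record at or after n)
    ([record_from_probability]).  So Z stopped at T has the law of X stopped at
    its last record.

    Taking differences in n, the paths of Z with T = n correspond to the paths
    of X for which n is a record and h (X_i) <= h (X_n) for all i >= n
    ([last_record_probability]); letting n grow, those with T = oo correspond
    to the paths of X with infinitely many records
    ([infinite_record_probability]).  In the second case Xbar is Z.  In the first
    one, by the Markov property at time n ([markov_property_path]), X after n is
    the chain started in X_n conditioned never to exceed the level h (X_n), which
    is how Xcheck continues Z ([spliced_finite_part]).  Adding the cases up,
    Xbar and X give the same probability to all cylinders, hence have the same
    law ([spliced_law]), and the Markov property passes from X to Xbar. *)

(** * Extending identities from generators *)

(** Dynkin's theorem as an induction principle.  [Q] is an arbitrary property of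
    sets, so that it can contain measurability together with an identity. *)
Lemma sigma_ind (T : Type) (G Q : set (set T)) :
  setI_closed G -> G `<=` Q -> Q setT -> (forall A, Q A -> Q (~` A)) ->
  (forall F : (set T)^nat, trivIset setT F -> (forall n, Q (F n)) ->
     Q (\bigcup_n F n)) ->
  <<s G >> `<=` Q.
Proof.
move=> GI GQ QT QC QU; rewrite -setI_closed_g_dynkin_g_sigma_algebra//.
by apply: smallest_sub => //; split.
Qed.

Section integral_functional.
Context (R : realType) (d : measure_display) (S : measurableType d).
Local Open Scope ereal_scope.
Implicit Types (Phi : (S -> \bar R) -> \bar R) (f g : S -> \bar R).

Definition ge0_mfun f := measurable_fun setT f /\ forall x, 0 <= f x.

(** What is common to integration against a measure, against a density along a
    map, and against a kernel. *)
Definition integral_functional Phi := [/\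
  forall f g, ge0_mfun f -> ge0_mfun g ->
    Phi (fun x => f x + g x) = Phi f + Phi g,
  forall (k : R) f, (0 <= k)%R -> ge0_mfun f ->
    Phi (fun x => k%:E * f x) = k%:E * Phi f
  & forall F : nat -> S -> \bar R, (forall n, ge0_mfun (F n)) ->
    (forall x, nondecreasing_seq (F ^~ x)) ->
    Phi (fun x => limn (F ^~ x)) = limn (fun n => Phi (F n))].

Import HBNNSimple.

(** Additivity and homogeneity reduce to simple functions, which approximate
    nonnegative measurable functions from below. *)
Lemma integral_functional_ext Phi Psi :
  integral_functional Phi -> integral_functional Psi ->
  (forall A, measurable A ->
    Phi (fun x => (\1_A x)%:E) = Psi (fun x => (\1_A x)%:E)) ->
  forall f, ge0_mfun f -> Phi f = Psi f.
Proof.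
move=> [PhiD PhiZ PhiL] [PsiD PsiZ PsiL] PhiPsi f [mf f0].
have mind A : measurable A -> ge0_mfun (fun x => (\1_A x)%:E).
  by move=> mA; split=> // ; exact/measurable_EFinP/measurable_indic.
have mZ (k : R) A : (0 <= k)%R -> measurable A ->
    ge0_mfun (fun x => k%:E * (\1_A x)%:E).
  move=> k0 mA; split => [|x]; last by rewrite mule_ge0.
  by apply: measurable_funeM; case: (mind _ mA).
have simple (g : {nnsfun S >-> R}) : Phi (EFin \o g) = Psi (EFin \o g).
  (* The absolute value makes the coefficients nonnegative for all r, which the
     induction over the values of g needs. *)
  have gE x : (g x)%:E = \sum_(r <- finmap.enum_fset (fset_set (range g)))
      (`|r|)%:E * (\1_(g @^-1` [set r]) x)%:E.
    rewrite {1}(fimfunE g) fsbig_finite//= sumEFin [in RHS]big_seq [in LHS]big_seq.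
    congr EFin; apply: eq_bigr => r; rewrite in_fset_set// inE => -[y _ <-].
    by rewrite ger0_norm//; exact: fun_ge0.
  rewrite (_ : EFin \o g = fun x => (g x)%:E)//.
  under eq_fun do rewrite gE.
  elim: (finmap.enum_fset _) => [|r s IH].
    under eq_fun do rewrite big_nil.
    have -> : (fun=> 0) = (fun x : S => (0 : R)%:E * (\1_[set: S] x)%:E).
      by apply: funext => x; rewrite mul0e.
    by rewrite PhiZ ?PsiZ ?mul0e//; exact: mind.
  under eq_fun do rewrite big_cons.
  have ms : ge0_mfun
      (fun x => \sum_(j <- s) `|j|%:E * (\1_(g @^-1` [set j]) x)%:E).
    split => [|x]; last by apply: sume_ge0 => *; rewrite mule_ge0.
    by apply: emeasurable_sum => j; apply: (mZ _ _ _ _).1.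
  rewrite PhiD ?PsiD//; [|exact: mZ..].
  by rewrite PhiZ ?PsiZ//; [rewrite IH PhiPsi|exact: mind..].
have mfT : measurable_fun setT f by [].
pose g := nnsfun_approx measurableT mfT.
have fE : f = fun x => limn (fun n => (g n x)%:E).
  apply/funext => x; apply/esym/cvg_lim => //.
  exact: (cvg_nnsfun_approx measurableT mfT (fun x _ => f0 x)).
have mg n : ge0_mfun (fun x => (g n x)%:E).
  by split=> [|x]; [exact/measurable_EFinP|rewrite lee_fin; exact: fun_ge0].
have ndg x : nondecreasing_seq (fun n => (g n x)%:E).
  by move=> m n mn; rewrite lee_fin; exact/lefP/nd_nnsfun_approx.
rewrite fE (PhiL (fun n x => (g n x)%:E))// (PsiL (fun n x => (g n x)%:E))//.
by congr (limn _); apply/funext => n; exact: simple.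
Qed.

Lemma integral_functional_comp (dT : measure_display) (T : measurableType dT)
    (mu : {measure set T -> \bar R}) (D : set T) (w : T -> R)
    (X : T -> S) :
  measurable D -> measurable_fun setT w -> (forall t, (0 <= w t)%R) ->
  measurable_fun setT X ->
  integral_functional (fun f => \int[mu]_(t in D) ((w t)%:E * f (X t))).
Proof.
move=> mD mw w0 mX.
have mwf f : ge0_mfun f -> measurable_fun D (fun t => (w t)%:E * f (X t)).
  move=> [mf f0]; apply: measurable_funTS; apply: emeasurable_funM.
    exact/measurable_EFinP.
  exact: measurableT_comp.
split.
- move=> f g mf mg; under eq_integral => t _ do rewrite (ge0_muleDr _ (mf.2 _) (mg.2 _)).
  rewrite ge0_integralD//; try exact: mwf.
  + by move=> t _; rewrite mule_ge0 ?lee_fin//; exact: mf.2.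
  + by move=> t _; rewrite mule_ge0 ?lee_fin//; exact: mg.2.
- move=> k f k0 mf; under eq_integral do rewrite muleCA.
  rewrite ge0_integralZl_EFin//; last exact: mwf.
  by move=> t _; rewrite mule_ge0 ?lee_fin//; exact: mf.2.
- move=> F mF ndF.
  have cF t : cvgn (F ^~ t) by exact: ereal_nondecreasing_is_cvgn.
  rewrite -monotone_convergence//.
  + by apply: eq_integral => t _; rewrite limeMl.
  + by move=> n; exact: mwf.
  + by move=> n t _; rewrite mule_ge0 ?lee_fin//; exact: (mF n).2.
  + by move=> t _ m n mn; rewrite lee_wpmul2l ?lee_fin//; exact: ndF.
Qed.
End integral_functional.

Lemma measurable_funV_ge0 (R : realType) (d : measure_display)
    (T : measurableType d) (f : T -> R) :
  measurable_fun setT f -> (forall x, 0 <= f x) ->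
  measurable_fun setT (fun x => (f x)^-1).
Proof.
move=> mf f0; rewrite (_ : (fun x => _) = (fun r : R => powR r (-1)) \o f).
  by apply: measurableT_comp => //; exact: measurable_powR.
by apply/funext => x /=; rewrite powR_inv1.
Qed.

Section change_of_variables.
Context (R : realType) (d : measure_display) (S : measurableType d).
Context (d1 : measure_display) (T1 : measurableType d1).
Context (d2 : measure_display) (T2 : measurableType d2).
Variables (mu1 : {measure set T1 -> \bar R}) (mu2 : {measure set T2 -> \bar R}).
Variables (D1 : set T1) (D2 : set T2) (X1 : T1 -> S).
Hypotheses (mD1 : measurable D1) (mD2 : measurable D2)
  (mX1 : measurable_fun setT X1).
Local Open Scope ereal_scope.

Let measurable_preimage_X1 A : measurable A -> measurable (X1 @^-1` A).
Proof. by move=> mA; rewrite -[X in measurable X]setTI; exact: mX1. Qed.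

Let functional1 : integral_functional (fun f => \int[mu1]_(t in D1) f (X1 t)).
Proof.
rewrite (_ : (fun f => _) =
    (fun f => \int[mu1]_(t in D1) ((cst 1%R t : R)%:E * f (X1 t)))).
  exact: integral_functional_comp.
by apply/funext => f; under [RHS]eq_integral do rewrite mul1e.
Qed.

Let functional1_indic A : measurable A ->
  \int[mu1]_(t in D1) (\1_A (X1 t))%:E = mu1 (D1 `&` X1 @^-1` A).
Proof.
move=> mA; rewrite setIC -integral_indic//.
exact: measurable_preimage_X1.
Qed.

(** Change of variables when the image of [mu1] on [D1] under [X1] is the image
    of [w mu2] on [D2] under [X2]. *)
Lemma integral_comp_density (X2 : T2 -> S) (w : T2 -> R) :
  measurable_fun setT X2 -> measurable_fun setT w -> (forall t, (0 <= w t)%R) ->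
  (forall A, measurable A ->
    mu1 (D1 `&` X1 @^-1` A) = \int[mu2]_(t in D2 `&` X2 @^-1` A) (w t)%:E) ->
  forall f, ge0_mfun f ->
    \int[mu1]_(t in D1) f (X1 t) = \int[mu2]_(t in D2) ((w t)%:E * f (X2 t)).
Proof.
move=> mX2 mw w0 law; apply: integral_functional_ext => //.
  exact: integral_functional_comp.
move=> A mA; rewrite functional1_indic// law// integral_mkcondr.
apply: eq_integral => t _; have -> : (\1_A (X2 t) : R) = \1_(X2 @^-1` A) t by rewrite !indicE.
rewrite patchE indicE.
by case: ifPn; rewrite ?mule1 ?mule0.
Qed.

(** Change of variables when the image of [mu1] on [D1] under [X1] is the mixture
    of the measures [k t] under [mu2] on [D2]. *)
Lemma integral_comp_kernel (k : T2 -> {measure set S -> \bar R}) :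
  (forall A, measurable A -> measurable_fun setT (fun t => k t A)) ->
  (forall A, measurable A ->
    mu1 (D1 `&` X1 @^-1` A) = \int[mu2]_(t in D2) k t A) ->
  forall f, ge0_mfun f ->
    \int[mu1]_(t in D1) f (X1 t) = \int[mu2]_(t in D2) \int[k t]_y f y.
Proof.
move=> mk law; apply: integral_functional_ext => //; last first.
  move=> A mA; rewrite functional1_indic// law//.
  by apply: eq_integral => t _; rewrite integral_indic// setIT.
have mkf f : ge0_mfun f -> measurable_fun D2 (fun t => \int[k t]_y f y).
  by move=> [mf f0]; apply: measurable_funTS; exact: measurable_fun_integral_kernel.
have kf0 f t : ge0_mfun f -> 0 <= \int[k t]_y f y.
  by move=> [_ f0]; exact: integral_ge0.
split.
- move=> f g mf mg; rewrite -ge0_integralD//; [|by move=> *; exact: kf0|exact: mkf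
    |by move=> *; exact: kf0|exact: mkf].
  apply: eq_integral => t _; rewrite ge0_integralD//; try exact: mf.1.
  + by move=> *; exact: mf.2.
  + by move=> *; exact: mg.2.
  + exact: mg.1.
- move=> c f c0 mf; rewrite -ge0_integralZl_EFin//; last 2 first.
  + by move=> *; exact: kf0.
  + exact: mkf.
  apply: eq_integral => t _; rewrite ge0_integralZl_EFin//; last exact: mf.1.
  by move=> *; exact: mf.2.
- move=> F mF ndF; rewrite -monotone_convergence//.
  + apply: eq_integral => t _; rewrite -monotone_convergence//.
    * by move=> n; exact: (mF n).1.
    * by move=> n *; exact: (mF n).2.
  + by move=> n; exact: mkf.
  + by move=> n *; exact: kf0.
  + move=> t _ m n mn; apply: ge0_le_integral => //.
    * by move=> *; exact: (mF m).2.
    * exact: (mF m).1.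
    * exact: (mF n).1.
    * by move=> y _; exact: ndF.
Qed.

End change_of_variables.

(** * Path events and cylinders *)

Section paths.
Context (d : measure_display) (S : measurableType d).
Implicit Types (I : set nat) (A : nat -> set S).

Definition path_sigma I : set (set (nat -> S)) :=
  sigma_process I (fun n (p : nat -> S) => p n).

(** Events of a process are path events pulled back along the trajectory map, so
    that identities between laws need only be shown for sets of paths. *)
Lemma sigma_processE (W : Type) I (X : nat -> W -> S) :
  sigma_process I X =
  preimage_set_system [set: W] (fun w n => X n w) (path_sigma I).
Proof.
rewrite /path_sigma /sigma_process -g_sigma_preimageE; congr (<<s _ >>).
apply/seteqP; split => [D [i Ii [B mB <-]]|D [_ [i Ii [B mB <-]] <-]].
  by exists [set p | B (p i)]; [exists i => //; exists B; rewrite ?setTI|].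
by exists i => //; exists B => //; rewrite !setTI.
Qed.

Lemma sigma_process_path (W : Type) I (X : nat -> W -> S) B :
  path_sigma I B -> sigma_process I X [set w | B (X ^~ w)].
Proof. by move=> mB; rewrite sigma_processE; exists B; rewrite ?setTI. Qed.

Lemma sigma_process_sub (W : Type) I (X : nat -> W -> S) (G : set (set W)) :
  sigma_algebra setT G ->
  (forall i B, I i -> measurable B -> G (X i @^-1` B)) ->
  sigma_process I X `<=` G.
Proof.
move=> sG mX; apply: smallest_sub => // _ [i Ii [B mB <-]].
by rewrite setTI; exact: mX.
Qed.

Lemma sigma_process_coord (W : Type) I (X : nat -> W -> S) i B :
  I i -> measurable B -> sigma_process I X (X i @^-1` B).
Proof.
by move=> Ii mB; apply: sub_sigma_algebra; exists i => //; exists B; rewrite ?setTI.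
Qed.

Lemma sigma_process_mono (W : Type) I J (X : nat -> W -> S) :
  I `<=` J -> sigma_process I X `<=` sigma_process J X.
Proof.
move=> IJ; apply: sigma_process_sub; first exact: smallest_sigma_algebra.
by move=> i B Ii mB; apply: sigma_process_coord => //; exact: IJ.
Qed.

Lemma path_sigma_mono I J : I `<=` J -> path_sigma I `<=` path_sigma J.
Proof. exact: sigma_process_mono. Qed.

Lemma sigma_process_measurable (dW : measure_display) (W : measurableType dW)
    I (X : nat -> W -> S) :
  (forall i, measurable_fun setT (X i)) -> sigma_process I X `<=` measurable.
Proof.
move=> mX; apply: sigma_process_sub; first exact: sigma_algebra_measurable.
by move=> i B _ mB; rewrite -[X in measurable X]setTI; exact: mX.
Qed.

Lemma measurable_path_event (dW : measure_display) (W : measurableType dW)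
    I (X : nat -> W -> S) B :
  (forall i, measurable_fun setT (X i)) -> path_sigma I B ->
  measurable [set w | B (X ^~ w)].
Proof.
by move=> mX /(sigma_process_path (X := X)); exact: sigma_process_measurable.
Qed.

Lemma path_event_bigcup (W : Type) (X : nat -> W -> S)
    (F : (set (nat -> S))^nat) :
  [set w | (\bigcup_n F n) (X ^~ w)] = \bigcup_n [set w | F n (X ^~ w)].
Proof. by apply/seteqP; split => w [n _ Fw]; exists n. Qed.

Lemma trivIset_path_event (W : Type) (X : nat -> W -> S)
    (F : (set (nat -> S))^nat) :
  trivIset setT F -> trivIset setT (fun n => [set w | F n (X ^~ w)]).
Proof.
move=> tF i j _ _ [w [Fi Fj]]; apply: tF => //.
by exists (X ^~ w).
Qed.

Definition cylinder A : set (nat -> S) := [set p | forall i, A i (p i)].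

(** The sides are indexed by all times and trivial from some time on; this makes
    cylinders stable under intersection without comparing lengths. *)
Definition cylinder_sides I A := [/\ forall i, measurable (A i),
  forall i, ~ I i -> A i = setT & exists n, forall i, (n <= i)%N -> A i = setT].

Definition cylinders I := [set cylinder A | A in cylinder_sides I].

Lemma setI_closed_cylinders I : setI_closed (cylinders I).
Proof.
move=> _ _ [A [mA AI [m Am]] <-] [B [mB BI [n Bn]] <-].
exists (fun i => A i `&` B i); last first.
  apply/seteqP; split => [p AB|p [Ap Bp] i]; last by split; [exact: Ap|exact: Bp].
  by split => i; have [] := AB i.
split=> [i|i Ii|]; first exact: measurableI.
  by rewrite AI// BI// setTI.
exists (maxn m n) => i; rewrite geq_max => /andP[mi ni].
by rewrite Am// Bn// setTI.
Qed.

Lemma path_sigma_cylinders I : path_sigma I `<=` <<s cylinders I >>.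
Proof.
apply: sigma_process_sub; first exact: smallest_sigma_algebra.
move=> i B Ii mB; apply: sub_sigma_algebra.
exists (fun j => if j == i then B else setT); last first.
  apply/seteqP; split => [p /(_ i)|p /= Bp j]; first by rewrite eqxx.
  by case: eqP => [->|].
split=> [j|j Ij|]; first by case: ifP.
  by case: eqP => // ji; rewrite ji in Ij.
by exists i.+1 => j ij; rewrite gtn_eqF.
Qed.

Lemma path_sigma_cylinder I A : cylinder_sides I A -> path_sigma I (cylinder A).
Proof.
move=> [mA AI _].
have -> : cylinder A = \bigcap_i [set p | A i (p i)].
  by apply/seteqP; split => [p Ap i _|p Ap i]; [exact: Ap|exact: Ap].
apply: (@bigcapT_measurable _ (g_sigma_algebraType
  (\bigcup_(i in I) preimage_set_system [set: nat -> S] (fun p => p i) measurable))).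
move=> i; have [Ii|nIi] := pselect (I i).
  exact: (@sigma_process_coord _ I (fun n p => p n)).
by rewrite (AI _ nIi); exact: measurableT.
Qed.

End paths.

Lemma adde_cancelr (R : realType) (z x y : \bar R) :
  (z \is a fin_num -> x + z = y + z -> x = y)%E.
Proof. by move=> fz xz; rewrite -(addeK x fz) xz addeK. Qed.

(** * The Markov property on path space *)

Section cylinder_probability.
Context (R : realType) (d : measure_display) (S : measurableType d).
Variable P : R.-pker S ~> S.
Local Open Scope ereal_scope.

(** The probability that the chain started in [x] meets the sides
    [A 0], ..., [A n.-1], by conditioning on the first step. *)
Fixpoint cylinder_prob n (A : nat -> set S) (x : S) : \bar R :=
  if n is n'.+1 then
    (\1_(A 0%N) x)%:E * \int[P x]_y cylinder_prob n' (fun i => A i.+1) y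
  else 1.

Lemma ge0_mfun_cylinder_prob n A :
  (forall i, measurable (A i)) -> ge0_mfun (cylinder_prob n A).
Proof.
elim: n A => [|n IH] A mA /=; first by split.
have [mc c0] := IH (fun i => A i.+1) (fun i => mA i.+1).
split=> [|x]; last by rewrite mule_ge0//; exact: integral_ge0.
apply: emeasurable_funM; first exact/measurable_EFinP/measurable_indic.
apply: measurable_fun_integral_kernel => // U mU.
exact: measurable_kernel.
Qed.

Context (dW : measure_display) (W : measurableType dW).
Variables (mu : probability W R) (x : S) (X : nat -> W -> S).
Hypothesis hX : markov_chain mu P x X.

Let mX n : measurable_fun setT (X n). Proof. by case: hX. Qed.

Let mX_preimage n A : measurable A -> measurable (X n @^-1` A).
Proof. by move=> mA; rewrite -[X in measurable X]setTI; exact: mX. Qed.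

(** The definition of a Markov chain concerns indicators; it extends to functions
    by [integral_comp_kernel]. *)
Lemma markov_chain_integral n D f :
  sigma_process [set i | (i <= n)%N] X D -> ge0_mfun f ->
  \int[mu]_(w in D) f (X n.+1 w) = \int[mu]_(w in D) \int[P (X n w)]_y f y.
Proof.
move=> FD mf.
have mD : measurable D := sigma_process_measurable mX FD.
apply: (@integral_comp_kernel _ _ _ _ _ _ _ mu mu D D (X n.+1) mD mD (mX _)
  (fun w => P (X n w))) => //.
  move=> A mA; apply: (measurableT_comp (f := P ^~ A)); last exact: mX.
  exact: measurable_kernel.
by move=> A mA; have [_ _] := hX; exact.
Qed.

(** Induction on the number of sides: the side at time m joins the past event and
    one step of the chain produces the integral in [cylinder_prob]. *)
Lemma markov_chain_cylinder n A m D :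
  (forall i, measurable (A i)) -> (forall i, (n <= i)%N -> A i = setT) ->
  sigma_process [set i | (i <= m)%N] X D ->
  mu (D `&` [set w | cylinder A (fun i => X (m + i)%N w)]) =
  \int[mu]_(w in D) cylinder_prob n A (X m w).
Proof.
elim: n A m D => [|n IH] A m D mA An FD.
  have mD := sigma_process_measurable mX FD.
  rewrite integral_cst// mul1e; congr (mu _).
  by apply/seteqP; split => [w []//|w Dw]; split => // i; rewrite An.
have FD' : sigma_process [set i | (i <= m)%N] X (D `&` X m @^-1` A 0%N).
  apply: (@measurableI _ (g_sigma_algebraType (\bigcup_(i in _)
    preimage_set_system [set: W] (X i) measurable))) => //.
  by apply: sigma_process_coord => /=.
rewrite [in LHS](_ : _ `&` _ = (D `&` X m @^-1` A 0%N) `&`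
    [set w | cylinder (fun i => A i.+1) (fun i => X (m.+1 + i)%N w)]); last first.
  apply/seteqP; split => [w [Dw Aw]|w [[Dw A0w] Aw]]; split => //=.
  - by split=> //=; have := Aw 0%N; rewrite addn0.
  - by move=> i; have := Aw i.+1; rewrite addnS.
  - by move=> [|i]; [rewrite addn0|have := Aw i; rewrite addnS].
have FD1 : sigma_process [set i | (i <= m.+1)%N] X (D `&` X m @^-1` A 0%N).
  by apply: sigma_process_mono FD' => i /= /leqW.
rewrite (IH _ m.+1 _ (fun i => mA i.+1) (fun i => An i.+1) FD1).
rewrite (markov_chain_integral FD')//; last first.
  by apply: ge0_mfun_cylinder_prob => i; exact: mA.
rewrite integral_mkcondr; apply: eq_integral => w _ /=.
have -> : (\1_(A 0%N) (X m w) : R) = \1_(X m @^-1` A 0%N) w by rewrite !indicE.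
by rewrite patchE indicE; case: ifPn; rewrite ?mul1e ?mul0e.
Qed.

Lemma markov_chain_integral0 f : ge0_mfun f -> \int[mu]_w f (X 0%N w) = f x.
Proof.
move=> mf.
rewrite (@integral_comp_density _ _ _ _ _ _ _ mu (\d_x) setT setT (X 0%N)
  measurableT measurableT (mX _) id (cst 1%R))//.
  rewrite integral_dirac//=; first by rewrite diracT mul1e mul1e.
  apply: emeasurable_funM => //; exact: mf.1.
move=> A mA; rewrite !setTI.
rewrite [RHS](_ : _ = \int[\d_x]_(t in A) cst 1 t)//.
by rewrite integral_cst// mul1e; case: hX => _ X0 _; exact: X0.
Qed.

Lemma markov_chain_cylinder_prob n A :
  (forall i, measurable (A i)) -> (forall i, (n <= i)%N -> A i = setT) ->
  mu [set w | cylinder A (X ^~ w)] = cylinder_prob n A x.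
Proof.
move=> mA An; have := @markov_chain_cylinder n A 0%N setT mA An.
rewrite setTI => ->; last exact: (@measurableT _ (g_sigma_algebraType _)).
by rewrite markov_chain_integral0//; exact: ge0_mfun_cylinder_prob.
Qed.

End cylinder_probability.

Section markov_property.
Context (R : realType) (d : measure_display) (S : measurableType d).
Variable P : R.-pker S ~> S.
Context (dW : measure_display) (W : measurableType dW).
Variables (X : nat -> W -> S) (Px : S -> probability W R).
Hypothesis hX : forall x, markov_chain (Px x) P x X.
Local Open Scope ereal_scope.

Definition path_law x (C : set (nat -> S)) : \bar R :=
  Px x [set w | C (X ^~ w)].

Let mX n : measurable_fun setT (X n). Proof. by case: (hX point). Qed.

(** Measurability in the initial state and the Markov property at a fixed time
    are proved together, as the second statement only makes sense with the first.
    Both hold on cylinders because [cylinder_prob] is measurable in the state. *)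
Lemma markov_property_path (C : set (nat -> S)) : path_measurable C ->
  measurable_fun setT (path_law ^~ C) /\
  forall x m D, sigma_process [set i | (i <= m)%N] X D ->
    Px x (D `&` [set w | C (fun i => X (m + i)%N w)]) =
    \int[Px x]_(w in D) path_law (X m w) C.
Proof.
pose shift m (C : set (nat -> S)) := [set w | C (fun i => X (m + i)%N w)].
pose Q := [set C | path_measurable C /\
  measurable_fun setT (path_law ^~ C) /\
  forall x m D, sigma_process [set i | (i <= m)%N] X D ->
    Px x (D `&` shift m C) = \int[Px x]_(w in D) path_law (X m w) C].
suff : path_measurable (S:=S) `<=` Q by move=> /[apply] -[].
move=> {}C /path_sigma_cylinders; apply: sigma_ind => {C}.
- exact: setI_closed_cylinders.
- move=> _ [A Ai <-]; have [mA _ [n An]] := Ai.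
  have lawE : path_law ^~ (cylinder A) = cylinder_prob P n A.
    apply/funext => x; exact: (@markov_chain_cylinder_prob _ _ _ P _ _ (Px x)).
  split; first exact: path_sigma_cylinder.
  rewrite lawE; split; first by apply: (ge0_mfun_cylinder_prob _ _ _).1.
  move=> x m D FD; rewrite (markov_chain_cylinder (hX x) mA An)//.
  by apply: eq_integral => w _; rewrite -lawE.
- split; first exact: (@measurableT _ (g_sigma_algebraType _)).
  have lawT y : path_law y setT = 1 by rewrite /path_law probability_setT.
  split; first by under eq_fun do rewrite lawT; exact: measurable_cst.
  move=> x m D FD; rewrite setIT; under eq_integral do rewrite lawT.
  have mD := sigma_process_measurable mX FD.
  by rewrite integral_cst// mul1e.
- move=> C [mC [mlaw eqC]].
  have mS m : measurable (shift m C).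
    exact: (measurable_path_event (X := fun i w => X (m + i)%N w) _ mC).
  have lawC y : path_law y (~` C) + path_law y C = 1.
    rewrite /path_law (_ : [set w | (~` C) (X ^~ w)] = ~` shift 0%N C)//.
    rewrite (probability_setC _ (mS 0%N)) subeK//.
    exact: fin_num_measure.
  have mlawC : measurable_fun setT (path_law ^~ (~` C)).
    rewrite (_ : path_law ^~ (~` C) = fun y => 1 - path_law y C).
      exact: emeasurable_funB.
    apply/funext => y; rewrite -(lawC y) addeK//.
    exact: (fin_num_measure _ _ (mS 0%N)).
  split; first exact: (@measurableC _ (g_sigma_algebraType _)).
  split=> // x m D FD; have mD := sigma_process_measurable mX FD.
  apply: (@adde_cancelr _ (Px x (D `&` shift m C))).
    exact/fin_num_measure/measurableI.
  rewrite [in RHS]eqC// -ge0_integralD//; first last.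
  + by apply: measurable_funTS; apply: (measurableT_comp (f := path_law ^~ C)).
  + by apply: measurable_funTS; apply: (measurableT_comp (f := path_law ^~ (~` C))).
  under eq_integral do rewrite lawC.
  rewrite integral_cst// mul1e.
  by rewrite [RHS](measureDI _ mD (mS m)).
- move=> F tF QF.
  have mS m n : measurable (shift m (F n)).
    by case: (QF n) => mF _; exact: (measurable_path_event (X := fun i w => X (m + i)%N w) _ mF).
  have shiftU m : shift m (\bigcup_n F n) = \bigcup_n shift m (F n).
    exact: (path_event_bigcup (fun i w => X (m + i)%N w)).
  have tS m : trivIset setT (fun n => shift m (F n)).
    exact: (trivIset_path_event (X := fun i w => X (m + i)%N w)).
  have lawU y : path_law y (\bigcup_n F n) = \sum_(n <oo) path_law y (F n).
    rewrite /path_law -[X in Px y X]/(shift 0%N _) shiftU.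
    rewrite (measure_semi_bigcup _ (mS 0%N) (tS 0%N))//.
    by apply: bigcup_measurable => n _; exact: mS.
  split.
    apply: (@bigcupT_measurable _ (g_sigma_algebraType _)) => n.
    by case: (QF n).
  split.
    under eq_fun do rewrite lawU.
    by apply: ge0_emeasurable_sum => n //; case: (QF n) => _ [].
  move=> x m D FD; have mD := sigma_process_measurable mX FD.
  under eq_integral do rewrite lawU.
  rewrite integral_nneseries//; last first.
    move=> n; apply: measurable_funTS; apply: (measurableT_comp (f := path_law ^~ (F n))) => //.
    by case: (QF n) => _ [].
  rewrite shiftU setI_bigcupr measure_semi_bigcup//.
  + by apply: eq_eseriesr => n _; case: (QF n) => _ [_ /(_ x m D FD)].
  + by move=> n; exact: measurableI.
  + exact: trivIset_setIl.
  + by apply: bigcup_measurable => n _; exact: measurableI.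
Qed.

End markov_property.

(** * The h-transformed chain has a density *)

Section htransform_density.
Context (R : realType) (d : measure_display) (S : measurableType d).
Variables (P : R.-pker S ~> S) (h : S -> R) (hP : is_harmonic P h).
Variables (o : S) (ho : 0 < h o).
Local Open Scope ereal_scope.

Let mh : measurable_fun setT h. Proof. by case: hP. Qed.
Let h0 x : (0 <= h x)%R. Proof. by case: hP. Qed.

(** The part of [A] where h vanishes does not contribute to the integral of h. *)
Lemma htransform_posval x A : measurable A ->
  htransform hP ho x (@posval _ _ _ _ ho @^-1` A) =
  ((h (posval x))^-1)%:E * \int[P (posval x)]_(y in A) (h y)%:E.
Proof.
move=> mA; rewrite [LHS]/(htransform_set hP x _) /htransform_set; congr (_ * _).
rewrite integral_mkcond [RHS]integral_mkcond; apply: eq_integral => y _.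
rewrite !patchE; case: ifPn => [|yA].
  by rewrite inE => -[z Az <-]; rewrite mem_set.
case: ifPn => //; rewrite inE => Ay.
have := h0 y; rewrite le_eqVlt => /predU1P[<-//|hy].
exfalso; move/negP: yA; apply; rewrite inE.
by exists (exist _ y hy).
Qed.

Context (d0 : measure_display) (W0 : measurableType d0) (Po : probability W0 R)
  (X : nat -> W0 -> S) (hX : markov_chain Po P o X).
Context (d1 : measure_display) (W : measurableType d1) (PP : probability W R)
  (Xhat : nat -> W -> posset ho)
  (hXhat : markov_chain PP (htransform hP ho) (pospt ho) Xhat).

Let Z n w := posval (Xhat n w).

Let mX n : measurable_fun setT (X n). Proof. by case: hX. Qed.

Lemma measurable_hchain n : measurable_fun setT (Z n).
Proof.
by case: hXhat => mXhat _ _; apply: measurableT_comp => //; exact: measurable_posval.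
Qed.

Lemma sigma_hchain I : sigma_process I Z `<=` sigma_process I Xhat.
Proof.
apply: sigma_process_sub; first exact: smallest_sigma_algebra.
move=> i B Ii mB; rewrite -[X in sigma_process _ _ X]/(Xhat i @^-1` (posval (ho := ho) @^-1` B)).
apply: sigma_process_coord => //.
rewrite -[X in measurable X]setTI; exact: measurable_posval.
Qed.

Lemma hchain_step n D A : sigma_process [set i | (i <= n)%N] Z D -> measurable A ->
  PP (D `&` Z n.+1 @^-1` A) =
  \int[PP]_(w in D) (((h (Z n w))^-1)%:E * \int[P (Z n w)]_(y in A) (h y)%:E).
Proof.
move=> /sigma_hchain FD mA; case: hXhat => _ _ /(_ n D (posval (ho := ho) @^-1` A)).
move=> ->//; last by rewrite -[X in measurable X]setTI; exact: measurable_posval.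
by apply: eq_integral => w _; rewrite htransform_posval.
Qed.

Lemma hchain0 A : measurable A -> PP (Z 0%N @^-1` A) = \d_o A.
Proof.
move=> mA; case: hXhat => _ /(_ (posval (ho := ho) @^-1` A)) + _.
move=> ->; last by rewrite -[X in measurable X]setTI; exact: measurable_posval.
by rewrite !diracE.
Qed.

Let weight m w := (h (X m w) / h o)%R.

Let mweight m : measurable_fun setT (weight m).
Proof. by apply: measurable_funM => //; exact: measurableT_comp. Qed.

Let weight_ge0 m w : (0 <= weight m w)%R.
Proof. by rewrite divr_ge0// h0. Qed.

Let set_side m B (A : nat -> set S) : nat -> set S :=
  fun i => if i == m then B else A i.

Let side_ok m m' B A : (m <= m')%N -> measurable B ->
  cylinder_sides [set i | (i <= m')%N] A ->
  cylinder_sides [set i | (i <= m')%N] (set_side m B A).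
Proof.
move=> mm' mB [mA AI [n An]]; split.
- by move=> i; rewrite /set_side; case: ifP.
- move=> i /= im'; rewrite /set_side; case: eqP => [im|_]; last exact: AI.
  by rewrite im in im'.
- exists (maxn n m.+1) => i; rewrite geq_max => /andP[ni mi].
  by rewrite /set_side gtn_eqF// An.
Qed.

(** In the induction step the factor 1 / h (Z_m) of the transformed kernel cancels
    the density h (X_m) / h o at time m, and the factor h under the integral gives
    the density at time m+1.  Where h (X_m) = 0 the cancellation fails, but there
    harmonicity makes the integral of h vanish. *)
Lemma hchain_density_cylinder m A :
  cylinder_sides [set i | (i <= m)%N] A ->
  PP [set w | cylinder A (Z ^~ w)] =
  \int[Po]_(w in [set w | cylinder A (X ^~ w)]) (weight m w)%:E.
Proof.
elim: m A => [|m IH] A sA; have [mA AI _] := sA.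
  have cyl0 (W' : Type) (Y : nat -> W' -> S) :
      [set w | cylinder A (Y ^~ w)] = Y 0%N @^-1` A 0%N.
    apply/seteqP; split => [w /(_ 0%N)//|w /= A0 [|i]//].
    by rewrite AI.
  rewrite !cyl0 hchain0//.
  pose g x := ((h x / h o)%R)%:E * (\1_(A 0%N) x)%:E.
  rewrite integral_mkcond (_ : \int[Po]_w _ = \int[Po]_w g (X 0%N w)); last first.
    apply: eq_integral => w _; rewrite patchE /g indicE.
    have -> : (w \in X 0%N @^-1` A 0%N) = (X 0%N w \in A 0%N) by [].
    by case: ifPn; rewrite ?mule1 ?mule0.
  rewrite (markov_chain_integral0 hX).
    by rewrite /g divff ?gt_eqF// mul1e diracE indicE.
  split => [|x]; last by rewrite mule_ge0// lee_fin divr_ge0// h0.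
  apply: emeasurable_funM; apply/measurable_EFinP; last exact: measurable_indic.
  exact: measurable_funM.
pose A' := set_side m.+1 setT A; pose B := A m.+1.
have sA' : cylinder_sides [set i | (i <= m)%N] A'.
  have [mA' AI' ex'] : cylinder_sides [set i | (i <= m.+1)%N] A' by exact: side_ok.
  split => // i /= im; rewrite /A' /set_side; case: eqP => // /eqP iSm.
  by apply: AI => /=; rewrite leq_eqVlt (negbTE iSm).
have cylS (W' : Type) (Y : nat -> W' -> S) : [set w | cylinder A (Y ^~ w)] =
    [set w | cylinder A' (Y ^~ w)] `&` Y m.+1 @^-1` B.
  apply/seteqP; split => [w Aw|w [Aw Bw] i].
    split; last exact: Aw.
    by move=> i; rewrite /A' /set_side; case: ifP => // _; exact: Aw.
  by have := Aw i; rewrite /A' /set_side; case: eqP => [->|].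
have FA' := path_sigma_cylinder sA'.
have FZ := sigma_process_path (X := Z) FA'.
have FX := sigma_process_path (X := X) FA'.
have mDZ := measurable_path_event measurable_hchain FA'.
have mDX := measurable_path_event mX FA'.
have mB : measurable B := mA m.+1.
rewrite !cylS hchain_step//.
pose f y := (((h o)^-1)%:E * (h y)%:E) * (\1_B y)%:E.
have mf : ge0_mfun f.
  split => [|x]; last by rewrite !mule_ge0// lee_fin ?invr_ge0 ?h0// ltW.
  apply: emeasurable_funM; last exact/measurable_EFinP/measurable_indic.
  by apply: emeasurable_funM => //; exact/measurable_EFinP.
pose k x := \int[P x]_(y in B) (h y)%:E.
have mk : ge0_mfun k.
  split => [|x]; last by apply: integral_ge0 => y _; rewrite lee_fin h0.
  rewrite /k; under eq_fun do rewrite integral_mkcond.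
  apply: measurable_fun_integral_kernel.
  - by move=> U mU; exact: measurable_kernel.
  - by move=> z; rewrite patchE; case: ifP => // _; rewrite lee_fin h0.
  - apply/(measurable_restrictT _ _).1 => //.
    by apply: measurable_funTS; exact/measurable_EFinP.
pose g x := ((h x)^-1)%:E * k x.
have mg : ge0_mfun g.
  split => [|x]; last by rewrite mule_ge0// ?mk.2// lee_fin invr_ge0 h0.
  apply: emeasurable_funM; last exact: mk.1.
  apply/measurable_EFinP.
  exact: measurable_funV_ge0.
transitivity (\int[PP]_(w in [set w | cylinder A' (Z ^~ w)]) g (Z m w)).
  by [].
rewrite (@integral_comp_density _ _ _ _ _ _ _ PP Po _ [set w | cylinder A' (X ^~ w)]
   (Z m) mDZ mDX (measurable_hchain m) (X m) (weight m))//; last first.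
  move=> C mC; pose A'' := set_side m (A' m `&` C) A'.
  have sA'' : cylinder_sides [set i | (i <= m)%N] A''.
    by apply: side_ok => //; apply: measurableI => //; case: sA'.
  have cyl'' (W' : Type) (Y : nat -> W' -> S) :
      [set w | cylinder A' (Y ^~ w)] `&` Y m @^-1` C =
      [set w | cylinder A'' (Y ^~ w)].
    apply/seteqP; split => [w [A'w Cw] i|w A''w].
      by rewrite /A'' /set_side; case: eqP => [->|_]; [split => //|]; exact: A'w.
    split; last by have := A''w m; rewrite /A'' /set_side eqxx => -[].
    move=> i; have := A''w i; rewrite /A'' /set_side.
    by case: eqP => [->[]|].
  by rewrite !cyl''; exact: IH.
transitivity (\int[Po]_(w in [set w | cylinder A' (X ^~ w)])
    \int[P (X m w)]_y f y).
  apply: eq_integral => w _; rewrite /g.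
  have -> : \int[P (X m w)]_y f y = ((h o)^-1)%:E * k (X m w).
    rewrite /k -ge0_integralZl_EFin//; first last.
    - by rewrite invr_ge0 ltW.
    - by apply: measurable_funTS; exact/measurable_EFinP.
    - by move=> y _; rewrite lee_fin h0.
    rewrite [RHS]integral_mkcond; apply: eq_integral => y _.
    by rewrite /f patchE indicE; case: ifPn; rewrite ?mule1 ?mule0.
  rewrite muleA -EFinM /weight.
  have [hX0|hX0] := eqVneq (h (X m w)) 0%R.
    suff -> : k (X m w) = 0 by rewrite !mule0.
    apply/eqP; rewrite eq_le mk.2 andbT /k.
    have [_ _ hE] := hP; rewrite -[leRHS]/(0%R%:E) -hX0 hE.
    apply: ge0_subset_integral => //; last by move=> y _; rewrite lee_fin h0.
    exact/measurable_EFinP.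
  by congr (_%:E * _); rewrite mulrAC divff// mul1r.
rewrite -(markov_chain_integral hX FX mf) integral_mkcondr.
apply: eq_integral => w _; rewrite patchE /f indicE.
have -> : (w \in X m.+1 @^-1` B) = (X m.+1 w \in B) by [].
by case: ifPn; rewrite ?mule1 ?mule0// /weight EFinM muleC.
Qed.

(** The past up to time m is generated by cylinders of that length. *)
Lemma hchain_density m B : path_sigma [set i | (i <= m)%N] B ->
  PP [set w | B (Z ^~ w)] =
  \int[Po]_(w in [set w | B (X ^~ w)]) (h (X m w) / h o)%:E.
Proof.
pose J := [set i | (i <= m)%N].
pose Q := [set B | path_sigma J B /\ PP [set w | B (Z ^~ w)] =
  \int[Po]_(w in [set w | B (X ^~ w)]) (h (X m w) / h o)%:E].
have mw : measurable_fun setT (fun w => (h (X m w) / h o)%:E).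
  exact/measurable_EFinP/mweight.
have QT : Q setT.
  have sT : cylinder_sides J (fun=> setT : set S) by split => //; exists 0%N.
  split; first exact: (@measurableT _ (g_sigma_algebraType _)).
  have -> : setT = cylinder (fun=> setT : set S) by apply/seteqP; split.
  exact: hchain_density_cylinder.
suff : path_sigma J `<=` Q by move=> /[apply] -[].
move=> {}B /path_sigma_cylinders; apply: sigma_ind => {B} //.
- exact: setI_closed_cylinders.
- move=> _ [A sA <-]; split; first exact: path_sigma_cylinder.
  exact: hchain_density_cylinder.
- move=> B [mB eqB].
  split; first exact: (@measurableC _ (g_sigma_algebraType _)).
  have mZ := measurable_path_event measurable_hchain mB.
  have mXB := measurable_path_event mX mB.
  apply: (@adde_cancelr _ (PP [set w | B (Z ^~ w)])); first exact: fin_num_measure.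
  rewrite [in RHS]eqB -[in LHS]measureU//; last by rewrite setICl.
  rewrite -[in RHS]ge0_integral_setU//.
  + by rewrite (setvU [set w | B (Z ^~ w)]) (setvU [set w | B (X ^~ w)]); exact: QT.2.
  + exact: measurableC.
  + exact: measurable_funTS.
  + by move=> w _; rewrite lee_fin divr_ge0 ?h0.
  + by apply/disj_setPS; rewrite (setICl [set w | B (X ^~ w)]).
  + exact: (measurableC mZ).
- move=> F tF QF; split.
    apply: (@bigcupT_measurable _ (g_sigma_algebraType _)) => n.
    by case: (QF n).
  have mZ n : measurable [set w | F n (Z ^~ w)].
    exact: (measurable_path_event measurable_hchain (QF n).1).
  have mXF n : measurable [set w | F n (X ^~ w)].
    exact: (measurable_path_event mX (QF n).1).
  rewrite !path_event_bigcup measure_semi_bigcup//; first last.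
  + exact: bigcupT_measurable.
  + exact: trivIset_path_event.
  rewrite ge0_integral_bigcup//; first last.
  + exact: trivIset_path_event.
  + by move=> w _; rewrite lee_fin divr_ge0 ?h0.
  + exact: measurable_funTS.
  by apply: eq_eseriesr => n _; exact: (QF n).2.
Qed.

End htransform_density.

(** * The independent level Y *)

Section independence.
Context (R : realType) (dW : measure_display) (W : measurableType dW)
  (PP : probability W R).
Variables (G : set (set W)) (Y : W -> R).
Hypotheses (GW : <<s G >> `<=` measurable) (mY : measurable_fun setT Y)
  (indep : independent_systems PP <<s G >>
     (preimage_set_system [set: W] Y measurable)).
Local Open Scope ereal_scope.

Local Notation WG := (g_sigma_algebraType G).

(** Independence says that the joint law of the identity, seen as a map to the
    space with the smaller sigma-algebra, and of [Y] is a product measure; the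
    event is then evaluated section by section. *)
Lemma probability_le_independent (D : set W) (V : W -> R) :
  <<s G >> D -> measurable_fun setT (V : WG -> R) ->
  PP (D `&` [set w | (V w <= Y w)%R]) =
  \int[PP]_(w in D) PP [set w' | (V w <= Y w')%R].
Proof.
move=> GD mV.
have mid : measurable_fun setT (id : W -> WG).
  by move=> _ B mB; rewrite setTI; exact: GW.
have mpair : measurable_fun setT (fun w => (w, Y w) : WG * R).
  exact: measurable_fun_pair.
pose X0 : {mfun W >-> WG} :=
  HB.pack (id : W -> WG) (isMeasurableFun.Build _ _ _ _ _ mid).
pose Y0 : {mfun W >-> R} := HB.pack Y (isMeasurableFun.Build _ _ _ _ _ mY).
pose XY0 : {mfun W >-> (WG * R)%type} :=
  HB.pack (fun w => (w, Y w) : WG * R) (isMeasurableFun.Build _ _ _ _ _ mpair).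
pose C := [set x : WG * R | D x.1 /\ (V x.1 <= x.2)%R].
have mC : measurable C.
  have -> : C = (fst @^-1` D) `&` [set x | ((V \o fst) x <= snd x)%R] by [].
  apply: measurable_fun_le.
  - rewrite -[X in measurable X]setTI.
    exact: (@measurable_fst _ _ WG R measurableT D GD).
  - apply: measurable_funTS.
    exact: (measurableT_comp (f := V : WG -> R) mV (@measurable_fst _ _ WG R)).
  - exact: (measurable_funTS (@measurable_snd _ _ WG R)).
transitivity (distribution PP XY0 C) => //.
rewrite -(@product_measure_unique _ _ _ _ _ (distribution PP X0)
  (distribution PP Y0) (distribution PP XY0) _ C mC); last first.
  move=> A B mA mB; apply: indep => //.
  by exists B; rewrite ?setTI.
rewrite /product_measure1 ge0_integral_distribution//; last first.
  exact: measurable_fun_xsection.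
rewrite [RHS]integral_mkcond; apply: eq_integral => w _.
rewrite patchE /= /distribution /pushforward /=; case: ifPn => Dw.
  congr (PP _); apply/seteqP; split => w' /=.
    by rewrite /xsection/= inE => -[].
  by move=> Vw; rewrite /xsection /= inE; split => //; exact: set_mem.
rewrite (_ : _ @^-1` _ = set0) ?measure0//.
apply/seteqP; split => // w'; rewrite /xsection /= inE => -[/mem_set Dw'].
by rewrite Dw' in Dw.
Qed.

End independence.

(** * Records *)

Section records.
Context (R : realType) (d : measure_display) (S : measurableType d) (h : S -> R).
Hypothesis mh : measurable_fun setT h.

Definition record_at m : set (nat -> S) :=
  [set p | forall j, (j < m)%N -> h (p j) < h (p m)].

Definition record_from n : set (nat -> S) :=
  [set p | exists2 m, (n <= m)%N & record_at m p].

(** These events are disjoint in m and depend on the path up to m only; they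
    decompose [record_from n]. *)
Definition first_record_from n m : set (nat -> S) :=
  record_at m `&` [set p | forall j, (n <= j)%N -> (j < m)%N -> ~ record_at j p].

Definition stay_below : set (nat -> S) := [set p | forall i, h (p i) <= h (p 0%N)].

Lemma path_sigma_le (I : set nat) i j : I i -> I j ->
  path_sigma I [set p | h (p i) <= h (p j)].
Proof.
move=> Ii Ij.
pose PT := g_sigma_algebraType (\bigcup_(k in I)
  preimage_set_system [set: nat -> S] (fun p => p k) measurable).
have mhc k : I k -> measurable_fun setT ((fun p => h (p k)) : PT -> R).
  move=> Ik _ B mB; rewrite setTI.
  rewrite -[X in measurable X]/((fun p : nat -> S => p k) @^-1` (h @^-1` B)).
  apply: (@sigma_process_coord _ _ _ I (fun n p => p n)) => //.
  by rewrite -[X in measurable X]setTI; exact: mh.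
have := @measurable_fun_le _ PT R setT _ _ measurableT (mhc i Ii) (mhc j Ij).
by rewrite setTI.
Qed.

Let past m := [set i | (i <= m)%N].

Lemma path_sigma_record_at m : path_sigma (past m) (record_at m).
Proof.
have -> : record_at m = \bigcap_j [set p | (j < m)%N -> h (p j) < h (p m)].
  by apply/seteqP; split => [p rp j _|p rp j]; [exact: rp|exact: rp].
apply: (@bigcapT_measurable _ (g_sigma_algebraType _)) => j.
have [jm|mj] := ltnP j m; last first.
  rewrite (_ : [set _ | _] = setT); first exact: measurableT.
  by apply/seteqP; split.
rewrite (_ : [set _ | _] = ~` [set p | h (p m) <= h (p j)]).
  apply: (@measurableC _ (g_sigma_algebraType _)).
  by apply: path_sigma_le; rewrite /past/= // ltnW.
by apply/seteqP; split => p /=; rewrite (ltNge (h (p j))); [move=> /(_ isT)/negP|move=> /negP].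
Qed.

Lemma path_sigma_first_record_from n m :
  path_sigma (past m) (first_record_from n m).
Proof.
have -> : first_record_from n m = record_at m `&`
    \bigcap_j [set p | (n <= j)%N -> (j < m)%N -> ~ record_at j p].
  by apply/seteqP; split => p [rm np]; split => // j; [move=> _|]; exact: np.
apply: (@measurableI _ (g_sigma_algebraType _)); first exact: path_sigma_record_at.
apply: (@bigcapT_measurable _ (g_sigma_algebraType _)) => j.
have [jm|mj] := boolP ((n <= j) && (j < m))%N; last first.
  rewrite (_ : [set _ | _] = setT); first exact: measurableT.
  by apply/seteqP; split => // p _ nj jm; rewrite nj jm in mj.
rewrite (_ : [set _ | _] = ~` record_at j).
  apply: (@measurableC _ (g_sigma_algebraType _)).
  have jm' : past j `<=` past m.
    by move=> i /= ij; case/andP: jm => _ /ltnW; exact: leq_trans.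
  exact: (path_sigma_mono jm' (@path_sigma_record_at j)).
case/andP: jm => nj jm.
by apply/seteqP; split => p /=; [exact|].
Qed.

Lemma record_fromE n : record_from n = \bigcup_k first_record_from n (n + k).
Proof.
apply/seteqP; split => [p [m nm rm]|p [k _ [rk _]]]; last first.
  by exists (n + k)%N => //; exact: leq_addr.
pose a m := (n <= m)%N && `[< record_at m p >].
have : exists m, a m by exists m; rewrite /a nm; exact/asboolP.
move=> /ex_minnP[k /andP[nk /asboolP rk] kmin].
exists (k - n)%N => //; rewrite subnKC//; split => // j nj jk rj.
have aj : a j by rewrite /a nj; exact/asboolP.
by have := kmin j aj; rewrite leqNgt jk.
Qed.

Lemma trivIset_first_record_from n :
  trivIset setT (fun k => first_record_from n (n + k)).
Proof.
apply/trivIsetP => i j _ _ ij; apply/seteqP; split => // p [[ri ni] [rj nj]].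
have [|] := ltnP i j => [lij|].
  by apply: (nj (n + i)%N) => //; rewrite ?leq_addr// ltn_add2l.
rewrite leq_eqVlt eq_sym (negbTE ij)/= => lji.
by apply: (ni (n + j)%N) => //; rewrite ?leq_addr// ltn_add2l.
Qed.

Lemma path_measurable_record_from n : path_measurable (record_from n).
Proof.
rewrite record_fromE; apply: (@bigcupT_measurable _ (g_sigma_algebraType _)) => k.
exact: (path_sigma_mono (@subsetT _ _) (@path_sigma_first_record_from n (n + k))).
Qed.

Lemma path_measurable_stay_below : path_measurable stay_below.
Proof.
have -> : stay_below = \bigcap_i [set p | h (p i) <= h (p 0%N)].
  by apply/seteqP; split => [p bp i _|p bp i]; exact: bp.
apply: (@bigcapT_measurable _ (g_sigma_algebraType _)) => i.
exact: path_sigma_le.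
Qed.

(** If n is a record and no later time is, then the first later time at which h
    exceeds its value at n would be a record; so there is no such time. *)
Lemma last_recordE n : record_from n `\` record_from n.+1 =
  record_at n `&` [set p | stay_below (fun i => p (n + i)%N)].
Proof.
apply/seteqP; split => [p [[m nm rm] nlater]|p [rn below]].
  have mn : m = n.
    apply/eqP; rewrite eqn_leq nm andbT leqNgt; apply/negP => nm'.
    by apply: nlater; exists m.
  rewrite mn in rm; split => //= i; rewrite addn0 leNgt; apply/negP => hi.
  pose a k := h (p n) < h (p (n + k)%N).
  have : exists k, a k by exists i.
  move=> /ex_minnP[k ak kmin]; apply: nlater.
  have k0 : (0 < k)%N by case: k ak {kmin} => //; rewrite /a addn0 ltxx.
  exists (n + k)%N; first by rewrite -addn1 leq_add2l.
  move=> j jnk; apply: le_lt_trans ak; have [jn|nj] := ltnP j n.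
    exact/ltW/rm.
  rewrite leNgt; apply/negP => hj.
  have := kmin (j - n)%N; rewrite /a subnKC// => /(_ hj).
  by rewrite leqNgt ltn_subLR// jnk.
split; first by exists n.
move=> [m nm rm]; have := below (m - n)%N; rewrite /= addn0 subnKC 1?ltnW//.
by rewrite leNgt (rm n).
Qed.

End records.

Section last_record_time.
Context (R : realType) (u : nat -> R) (y : R).
Local Notation T := (last_record u y).
Local Open Scope ereal_scope.

(** The records of level at most y form a nonempty set of natural numbers, as 0
    belongs to it vacuously; so its supremum is either attained or infinite. *)
Lemma last_record_geP n : n%:R%:E <= T <->
  exists2 m, (n <= m)%N & forall j, (j < m)%N -> (u j < u m)%R /\ (u m <= y)%R.
Proof.
split=> [nT|[m nm rm]]; last first.
  apply: (@le_trans _ _ m%:R%:E); first by rewrite lee_fin ler_nat.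
  by apply: ereal_sup_ubound; exists m.
apply: contrapT => noR; move: nT; apply/negP; rewrite -ltNge.
case: n noR => [|n] noR; first by exfalso; apply: noR; exists 0%N.
apply: (@le_lt_trans _ _ n%:R%:E); last by rewrite lte_fin ltr_nat.
apply: ge_ereal_sup => _ [m rm <-]; rewrite lee_fin ler_nat leqNgt.
by apply/negP => nm; apply: noR; exists m.
Qed.

Lemma last_record_eqP n : T = n%:R%:E <-> n%:R%:E <= T /\ ~ n.+1%:R%:E <= T.
Proof.
split=> [->|[nT /last_record_geP nSn]].
  by split => //; rewrite lee_fin ler_nat ltnn.
apply/eqP; rewrite eq_le nT andbT.
apply: ge_ereal_sup => _ [m rm <-]; rewrite lee_fin ler_nat leqNgt.
by apply/negP => nm; apply: nSn; exists m.
Qed.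

Lemma last_record_finP : T < +oo -> exists n, T = n%:R%:E.
Proof.
move=> Toy.
have T0 : 0%:R%:E <= T by apply/last_record_geP; exists 0%N.
have : exists n, ~~ (n%:R%:E <= T).
  case: T Toy T0 => // r _ r0; exists (Num.truncn r).+1.
  by rewrite -ltNge lte_fin truncnS_gt.
move=> /ex_minnP[[|n] nT nmin]; first by rewrite T0 in nT.
exists n; apply/last_record_eqP; split; last exact/negP.
by apply: contrapT => /negP /nmin; rewrite ltnn.
Qed.

Lemma last_record_inftyP : T = +oo <-> forall n, n%:R%:E <= T.
Proof.
split=> [-> n|nT]; first by rewrite leey.
apply/eqP; rewrite -leye_eq leNgt; apply/negP => /last_record_finP[n Tn].
by have := nT n.+1; rewrite Tn lee_fin ler_nat ltnn.
Qed.

End last_record_time.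

(** The tail is given for strict inequalities; as it is continuous, Y has no atom
    and the weak inequality has the same probability. *)
Lemma probability_ge_inverse_uniform (R : realType) (dW : measure_display)
    (W : measurableType dW) (PP : probability W R) (Y : W -> R) (c : R) :
  measurable_fun setT Y -> 0 < c -> (forall w, c < Y w) ->
  (forall y, c <= y -> PP [set w | y < Y w] = (c / y)%:E) ->
  forall v, PP [set w | v <= Y w] = (c / Num.max v c)%:E.
Proof.
move=> mY c0 Yc Ylaw v.
have mle y : measurable [set w | y <= Y w].
  by have := measurable_fun_le measurableT (measurable_cst y) mY; rewrite setTI.
have mlt y : measurable [set w | y < Y w].
  rewrite (_ : [set _ | _] = ~` [set w | Y w <= y]).
    apply: measurableC.
    by have := measurable_fun_le measurableT mY (measurable_cst y); rewrite setTI.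
  by apply/seteqP; split => w /=; rewrite ltNge => /negP.
have [vc|cv] := leP v c.
  rewrite divff ?gt_eqF// (_ : [set _ | _] = setT) ?probability_setT//.
  by apply/seteqP; split => // w _ /=; exact: le_trans (ltW (Yc w)).
have v0 : 0 < v by exact: lt_trans cv.
apply/eqP; rewrite eq_le; apply/andP; split; last first.
  rewrite -(Ylaw v (ltW cv)); apply: le_measure; rewrite ?inE//.
  by move=> w /= /ltW.
have upper y : c <= y -> y < v -> (PP [set w | (v <= Y w)%R] <= (c / y)%:E)%E.
  move=> cy yv; rewrite -Ylaw//; apply: le_measure; rewrite ?inE//.
  by move=> w /=; exact: lt_le_trans.
have : (PP [set w | (v <= Y w)%R] <= 1)%E by exact: probability_le1.
have : (0 <= PP [set w | (v <= Y w)%R])%E by [].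
case: (PP _) upper => // p upper p0; rewrite !lee_fin in p0 * => p1.
rewrite leNgt; apply/negP => cvp.
(* If the probability p of Y >= v exceeded c / v, the level c / q < v with
   c / v < q < p would have tail q < p. *)
pose q := (p + c / v) / 2.
have qp : q < p by rewrite /q; lra.
have q1 : q < 1 by lra.
have cvq : c / v < q by rewrite /q; lra.
have q0 : 0 < q by apply: lt_trans cvq; rewrite divr_gt0.
have cqq : c / (c / q) = q by field; rewrite !gt_eqF.
have cq : c <= c / q by rewrite ler_pdivlMr// ger_pMr// ltW.
have qv : c / q < v by rewrite ltr_pdivrMr// mulrC -ltr_pdivrMr.
by have := upper (c / q) cq qv; rewrite lee_fin cqq leNgt qp.
Qed.

(** * The law of the h-transformed chain up to its last record below Y *)

Section last_record_law.
Context (R : realType) (d : measure_display) (S : measurableType d).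
Variables (P : R.-pker S ~> S) (h : S -> R) (hP : is_harmonic P h).
Variables (o : S) (ho : 0 < h o).
Context (d0 : measure_display) (W0 : measurableType d0) (Po : probability W0 R)
  (X : nat -> W0 -> S) (hX : markov_chain Po P o X).
Context (d1 : measure_display) (W : measurableType d1) (PP : probability W R)
  (Xhat : nat -> W -> posset ho)
  (hXhat : markov_chain PP (htransform hP ho) (pospt ho) Xhat).
Variables (Y : W -> R) (mY : measurable_fun [set: W] Y)
  (Yrange : forall w, h o < Y w)
  (Ylaw : forall y, h o <= y -> PP [set w | y < Y w] = (h o / y)%:E)
  (Yindep : independent_systems PP (sigma_process [set: nat] Xhat)
     (preimage_set_system [set: W] Y measurable)).
Local Open Scope ereal_scope.

Let Z n w := posval (Xhat n w).
Let T w := last_record (fun n => h (Z n w)) (Y w).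
Let past m := [set i | (i <= m)%N].

Let mh : measurable_fun setT h. Proof. by case: hP. Qed.
Let h0 x : (0 <= h x)%R. Proof. by case: hP. Qed.
Let mX n : measurable_fun setT (X n). Proof. by case: hX. Qed.
Let mZ n : measurable_fun setT (Z n). Proof. exact: (measurable_hchain hXhat). Qed.

Let X0_ae : {ae Po, forall w, h (X 0%N w) = h o}.
Proof.
exists (X 0%N @^-1` (h @^-1` [set~ h o])); split => //.
- have mB : measurable (h @^-1` [set~ h o]).
    by rewrite -[X in measurable X]setTI; apply: mh => //; exact: measurableC.
  by rewrite -[X in measurable X]setTI; exact: mX.
- case: hX => _ -> //; first by rewrite diracE memNset//= => /(_ erefl).
  by rewrite -[X in measurable X]setTI; apply: mh => //; exact: measurableC.
Qed.

Let integral_ae1 A (f : W0 -> \bar R) :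
  measurable [set w | A (X ^~ w)] -> measurable_fun setT f -> (forall w, 0 <= f w) ->
  (forall w, A (X ^~ w) -> h (X 0%N w) = h o -> f w = 1) ->
  \int[Po]_(w in [set w | A (X ^~ w)]) f w = Po [set w | A (X ^~ w)].
Proof.
move=> mA mf f0 f1; rewrite -[RHS]mul1e -integral_cst//; apply: ge0_ae_eq_integral => //.
  exact: measurable_funTS.
by apply: filterS X0_ae => w X0 Aw; rewrite f1.
Qed.

(** The tail h o / h (Z_m) of Y cancels the density h (X_m) / h o.  At time 0 the
    density is almost surely 1 and no bound by Y is imposed: 0 always belongs to the
    set whose supremum is T. *)
Lemma record_probability m A :
  path_sigma (past m) A -> A `<=` record_at h m ->
  PP ([set w | A (Z ^~ w)] `&` [set w | (0 < m)%N -> (h (Z m w) <= Y w)%R]) =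
  Po [set w | A (X ^~ w)].
Proof.
move=> FA Arec; have mAX := measurable_path_event mX FA.
have mw : measurable_fun setT (fun w => (h (X m w) / h o)%R).
  by apply: measurable_funM => //; exact: measurableT_comp.
have w0 w : (0 <= h (X m w) / h o)%R by rewrite divr_ge0// h0.
have [m0|m0] := posnP m.
  rewrite (_ : [set w | _ -> _] = setT) ?setIT; last first.
    by apply/seteqP; split => // w _ /=; rewrite m0.
  rewrite (hchain_density hX hXhat FA) integral_ae1//; first exact/measurable_EFinP.
  by move=> w _ X0; rewrite m0 X0 divff// gt_eqF.
have FZ : sigma_process setT Xhat [set w | A (Z ^~ w)].
  apply: sigma_hchain; apply: sigma_process_path.
  exact: (path_sigma_mono (@subsetT _ _) FA).
rewrite (_ : [set w | _ -> _] = [set w | (h (Z m w) <= Y w)%R]); last first.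
  by apply/seteqP; split => w /=; [exact|].
have mXhat n : measurable_fun setT (Xhat n) by case: hXhat.
rewrite (probability_le_independent _ mY Yindep FZ); first last.
- move=> _ B mB; rewrite setTI.
  rewrite -[X in measurable X]/(Xhat m @^-1` (posval (ho := ho) @^-1` (h @^-1` B))).
  apply: (@sigma_process_coord _ _ _ setT Xhat) => //.
  rewrite -[X in measurable X]setTI; apply: measurable_posval => //.
  by rewrite -[X in measurable X]setTI; exact: mh.
- exact: sigma_process_measurable.
(* The maximum makes the formula for the tail valid at all points, though on A
   one has h (X_m) > h (X_0) = h o almost surely. *)
pose f x := (h o / Num.max (h x) (h o))%:E.
have max0 x : (0 < Num.max (h x) (h o))%R by rewrite lt_max ho orbT.
have mf : ge0_mfun f.
  split => [|x]; last by rewrite lee_fin divr_ge0// ltW.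
  apply/measurable_EFinP; apply: measurable_funM => //.
  apply: measurable_funV_ge0; first exact: measurable_maxr.
  by move=> x; exact: ltW.
transitivity (\int[PP]_(w in [set w | A (Z ^~ w)]) f (Z m w)).
  apply: eq_integral => w _.
  exact: (probability_ge_inverse_uniform mY ho Yrange Ylaw).
have mAZ := measurable_path_event mZ FA.
rewrite (@integral_comp_density _ _ _ _ _ _ _ PP Po _ [set w | A (X ^~ w)]
  (Z m) mAZ mAX (mZ m) (X m) (fun w => (h (X m w) / h o)%R))//; last first.
  move=> B mB.
  have FAB : path_sigma (past m) (A `&` [set p | B (p m)]).
    apply: (@measurableI _ (g_sigma_algebraType _)) => //.
    apply: (@sigma_process_coord _ _ _ (past m) (fun n p => p n)) => //.
    exact: leqnn.
  exact: (hchain_density hX hXhat FAB).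
rewrite integral_ae1//.
- apply: emeasurable_funM; first exact/measurable_EFinP.
  by apply: measurableT_comp => //; exact: mf.1.
- by move=> w; apply: mule_ge0; [rewrite lee_fin; exact: w0|exact: mf.2].
- move=> w /Arec /(_ 0%N m0) + X0; rewrite X0 => /ltW hle.
  have hXm : (0 < h (X m w))%R by apply: lt_le_trans hle.
  rewrite /f -EFinM max_l//; congr EFin; field.
  by rewrite !gt_eqF.
Qed.

(** T >= n says that some record m >= n has a value at most Y, and then so does
    the first record at or after n.  [record_probability] applies at the latter,
    whose events are disjoint. *)
Lemma record_from_probability n A : path_sigma (past n) A ->
  PP ([set w | A (Z ^~ w)] `&` [set w | n%:R%:E <= T w]) =
  Po ([set w | A (X ^~ w)] `&` [set w | record_from h n (X ^~ w)]).
Proof.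
move=> FA.
pose N k := A `&` first_record_from h n (n + k).
have FN k : path_sigma (past (n + k)) (N k).
  apply: (@measurableI _ (g_sigma_algebraType _)).
    by apply: (path_sigma_mono _ FA) => i /= ni; apply: leq_trans ni _; exact: leq_addr.
  exact: path_sigma_first_record_from.
pose EZ k := [set w | N k (Z ^~ w)] `&`
  [set w | (0 < n + k)%N -> (h (Z (n + k)%N w) <= Y w)%R].
pose EX k := [set w | N k (X ^~ w)].
have tN (W' : Type) (V : nat -> W' -> S) : trivIset setT (fun k => [set w | N k (V ^~ w)]).
  apply: trivIset_path_event; apply: trivIset_setIl.
  exact: trivIset_first_record_from.
have mEX k : measurable (EX k) := measurable_path_event mX (FN k).
have mEZ k : measurable (EZ k).
  apply: measurableI; first exact: (measurable_path_event mZ (FN k)).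
  have [nk|nk] := posnP (n + k)%N.
    rewrite (_ : [set _ | _] = setT)//.
    by apply/seteqP; split => // w.
  rewrite (_ : [set w | _ -> _] = [set w | (h (Z (n + k)%N w) <= Y w)%R]).
    rewrite -[X in measurable X]setTI; apply: measurable_fun_le => //.
    exact: measurableT_comp.
  by apply/seteqP; split => w /=; [exact|].
have -> : [set w | A (X ^~ w)] `&` [set w | record_from h n (X ^~ w)] = \bigcup_k EX k.
  rewrite record_fromE.
  apply/seteqP; split => [w [Aw [k _ Nw]]|w [k _ [Aw Nw]]]; first by exists k.
  by split => //; exists k.
have -> : [set w | A (Z ^~ w)] `&` [set w | n%:R%:E <= T w] = \bigcup_k EZ k.
  apply/seteqP; split => [w [Aw /last_record_geP[m nm Em]]|w [k _ [[Aw [rk nk]] Yk]]].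
    have : record_from h n (Z ^~ w) by exists m => // j /Em [].
    rewrite record_fromE => -[k _ Nk]; exists k => //; split => // nk0.
    have nkm : (n + k <= m)%N.
      rewrite leqNgt; apply/negP => mnk.
      by case: Nk => _ /(_ m nm mnk); apply => j /Em [].
    move: nkm; rewrite leq_eqVlt => /predU1P[nkm|nkm].
      by rewrite nkm in nk0 *; case: (Em 0%N nk0).
    have [h1 h2] := Em _ nkm.
    exact: le_trans (ltW h1) h2.
  split => //; apply/last_record_geP; exists (n + k)%N; first exact: leq_addr.
  by move=> j jnk; split; [exact: rk|apply: Yk; exact: leq_ltn_trans jnk].
have tEZ : trivIset setT EZ.
  apply/trivIsetP => i j _ _ ij; apply/seteqP; split => // w [[Ni _] [Nj _]].
  have /trivIsetP/(_ i j Logic.I Logic.I ij) Nij := tN _ Z.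
  by rewrite -Nij.
rewrite (measure_semi_bigcup _ mEZ tEZ (bigcupT_measurable _ mEZ)).
rewrite (measure_semi_bigcup _ mEX (tN _ X) (bigcupT_measurable _ mEX)).
apply: eq_eseriesr => k _; apply: record_probability => //.
by move=> p [_ []].
Qed.

Lemma sigma_last_record_ge n :
  <<s sigma_process [set: nat] Xhat `|` preimage_set_system [set: W] Y measurable >>
  [set w | n%:R%:E <= T w].
Proof.
set G := _ `|` _.
pose WG := g_sigma_algebraType G.
have mhZ k : measurable_fun setT ((fun w => h (Z k w)) : WG -> R).
  move=> _ B mB; rewrite setTI; apply: sub_sigma_algebra; left.
  apply: (@sigma_process_coord _ _ _ setT Xhat k
    (posval (ho := ho) @^-1` (h @^-1` B))) => //.
  rewrite -[X in measurable X]setTI; apply: measurable_posval => //.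
  by rewrite -[X in measurable X]setTI; exact: mh.
have mYG : measurable_fun setT (Y : WG -> R).
  move=> _ B mB; apply: sub_sigma_algebra; right; exists B => //.
have -> : [set w | n%:R%:E <= T w] =
    \bigcup_m (if (n <= m)%N then
      \bigcap_j (if (j < m)%N then [set w | (h (Z m w) <= Y w)%R] `\`
          [set w | (h (Z m w) <= h (Z j w))%R] else setT) else set0).
  apply/seteqP; split => [w /last_record_geP[m nm Em]|w [m _]].
    exists m => //; rewrite nm => j _; case: ifP => // /Em[jm mYw].
    by split => //=; apply/negP; rewrite -ltNge.
  case: ifP => // nm Em; apply/last_record_geP; exists m => // j jm.
  by have := Em j Logic.I; rewrite jm => -[mYw /negP]; rewrite -ltNge.
apply: (@bigcupT_measurable _ WG) => m; case: ifP => _; last exact: measurable0.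
apply: bigcapT_measurable => j; case: ifP => _; last exact: measurableT.
apply: measurableD; rewrite -[X in measurable X]setTI.
  exact: (@measurable_fun_le _ WG R).
exact: (@measurable_fun_le _ WG R).
Qed.

Lemma sigma_last_record_eq n :
  <<s sigma_process [set: nat] Xhat `|` preimage_set_system [set: W] Y measurable >>
  [set w | T w = n%:R%:E].
Proof.
rewrite (_ : [set _ | _] = [set w | n%:R%:E <= T w] `\` [set w | n.+1%:R%:E <= T w]).
  by apply: (@measurableD _ (g_sigma_algebraType _)); exact: sigma_last_record_ge.
by apply/seteqP; split => w /last_record_eqP.
Qed.

Lemma measurable_information :
  <<s sigma_process [set: nat] Xhat `|` preimage_set_system [set: W] Y measurable >>
  `<=` measurable.
Proof.
apply: smallest_sub; first exact: sigma_algebra_measurable.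
move=> D [|[B mB <-]]; last exact: mY.
by apply: sigma_process_measurable; case: hXhat.
Qed.

Let mT n : measurable [set w | n%:R%:E <= T w].
Proof. exact: (measurable_information (@sigma_last_record_ge n)). Qed.

(** The difference of [record_from_probability] at n and at n+1. *)
Lemma last_record_probability n A : path_sigma (past n) A ->
  PP ([set w | A (Z ^~ w)] `&` [set w | T w = n%:R%:E]) =
  Po ([set w | A (X ^~ w)] `&` [set w | record_at h n (X ^~ w)] `&`
      [set w | stay_below h (fun i => X (n + i)%N w)]).
Proof.
move=> FA; have mAZ := measurable_path_event mZ FA.
have mAX := measurable_path_event mX FA.
have FA' : path_sigma (past n.+1) A.
  by apply: (path_sigma_mono _ FA) => i /= /leqW.
have mrec m := measurable_path_event mX (@path_measurable_record_from _ _ _ h mh m).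
have eZ : PP ([set w | A (Z ^~ w)] `&` [set w | n%:R%:E <= T w]) =
  PP ([set w | A (Z ^~ w)] `&` [set w | T w = n%:R%:E]) +
  PP ([set w | A (Z ^~ w)] `&` [set w | n.+1%:R%:E <= T w]).
  rewrite (measureDI PP (measurableI _ _ mAZ (mT n)) (mT n.+1)).
  congr (PP _ + PP _); apply/seteqP; split => w /=.
  - by move=> [[Aw nT] nSn]; split => //; exact/last_record_eqP.
  - by move=> [Aw /last_record_eqP[]].
  - by move=> [[]].
  - move=> [Aw nT]; split => //; split => //.
    by apply: le_trans nT; rewrite lee_fin ler_nat.
have eX : Po ([set w | A (X ^~ w)] `&` [set w | record_from h n (X ^~ w)]) =
  Po ([set w | A (X ^~ w)] `&` [set w | record_at h n (X ^~ w)] `&`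
      [set w | stay_below h (fun i => X (n + i)%N w)]) +
  Po ([set w | A (X ^~ w)] `&` [set w | record_from h n.+1 (X ^~ w)]).
  have /seteqP[s1 s2] := @last_recordE _ _ _ h n.
  rewrite (measureDI Po (measurableI _ _ mAX (mrec n)) (mrec n.+1)).
  congr (Po _ + Po _); apply/seteqP; split => w /=.
  - by move=> [[Aw rn] nrS]; have [] := s1 (X ^~ w) (conj rn nrS).
  - by move=> [[Aw rn] bw]; have [] := s2 (X ^~ w) (conj rn bw).
  - by move=> [[]].
  - move=> [Aw [m nm rm]]; split; last by exists m.
    by split => //; exists m => //; exact: ltnW.
apply: (@adde_cancelr _ (PP ([set w | A (Z ^~ w)] `&` [set w | n.+1%:R%:E <= T w]))).
  exact/fin_num_measure/measurableI.
rewrite -eZ record_from_probability// eX; congr (_ + _).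
by rewrite record_from_probability.
Qed.

(** The limit of [record_from_probability] along times n+k. *)
Lemma infinite_record_probability n A : path_sigma (past n) A ->
  PP ([set w | A (Z ^~ w)] `&` [set w | T w = +oo]) =
  Po ([set w | A (X ^~ w)] `&` [set w | forall m, record_from h m (X ^~ w)]).
Proof.
move=> FA; have mAZ := measurable_path_event mZ FA.
have mAX := measurable_path_event mX FA.
have mrec m := measurable_path_event mX (@path_measurable_record_from _ _ _ h mh m).
pose FZ k := [set w | A (Z ^~ w)] `&` [set w | (n + k)%:R%:E <= T w].
pose FX k := [set w | A (X ^~ w)] `&` [set w | record_from h (n + k) (X ^~ w)].
have FZX k : PP (FZ k) = Po (FX k).
  apply: record_from_probability.
  by apply: (path_sigma_mono _ FA) => i /= ni; apply: leq_trans ni _; exact: leq_addr.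
have mFZ k : measurable (FZ k) by exact: measurableI.
have mFX k : measurable (FX k) by exact: measurableI.
have -> : [set w | A (Z ^~ w)] `&` [set w | T w = +oo] = \bigcap_k FZ k.
  apply/seteqP; split => [w [Aw Tw] k _|w FZw].
    by split => //=; rewrite Tw leey.
  split; first by case: (FZw 0%N Logic.I).
  apply/last_record_inftyP => m; have [_ /=] := FZw m Logic.I.
  by apply: le_trans; rewrite lee_fin ler_nat leq_addl.
have -> : [set w | A (X ^~ w)] `&` [set w | forall m, record_from h m (X ^~ w)]
    = \bigcap_k FX k.
  apply/seteqP; split => [w [Aw rw] k _|w FXw]; first by split => //; exact: rw.
  split; first by case: (FXw 0%N Logic.I).
  move=> m; have [_ [i mi ri]] := FXw m Logic.I; exists i => //.
  by apply: leq_trans mi; rewrite leq_addl.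
have cZ : PP \o FZ @ \oo --> PP (\bigcap_k FZ k).
  apply: nonincreasing_cvg_mu => //.
  - by rewrite (le_lt_trans (probability_le1 _ _))// ltry.
  - exact: bigcapT_measurable.
  - move=> i j ij; apply/subsetPset => w [Aw jT]; split => //=.
    by apply: le_trans jT; rewrite lee_fin ler_nat leq_add2l.
have cX : Po \o FX @ \oo --> Po (\bigcap_k FX k).
  apply: nonincreasing_cvg_mu => //.
  - by rewrite (le_lt_trans (probability_le1 _ _))// ltry.
  - exact: bigcapT_measurable.
  - move=> i j ij; apply/subsetPset => w [Aw [k jk rk]]; split => //; exists k => //.
    by apply: leq_trans jk; rewrite leq_add2l.
apply: (cvg_unique _ cZ) => //.
by rewrite (_ : PP \o FZ = Po \o FX)//; apply/funext => k; exact: FZX.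
Qed.

End last_record_law.

(** * Comparing laws on path space *)

Lemma eq_path_law (R : realType) (d : measure_display) (S : measurableType d)
    (d1 d2 : measure_display) (W1 : measurableType d1) (W2 : measurableType d2)
    (mu1 : probability W1 R) (mu2 : probability W2 R)
    (X1 : nat -> W1 -> S) (X2 : nat -> W2 -> S) :
  (forall n, measurable_fun setT (X1 n)) ->
  (forall n, measurable_fun setT (X2 n)) ->
  (forall A, cylinder_sides setT A ->
    mu1 [set w | cylinder A (X1 ^~ w)] = mu2 [set w | cylinder A (X2 ^~ w)]) ->
  forall B, path_measurable B ->
    mu1 [set w | B (X1 ^~ w)] = mu2 [set w | B (X2 ^~ w)].
Proof.
move=> mX1 mX2 cyl.
pose Q := [set B | path_measurable B /\
  mu1 [set w | B (X1 ^~ w)] = mu2 [set w | B (X2 ^~ w)]].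
suff sub : path_measurable (S:=S) `<=` Q by move=> B /sub[].
move=> B /path_sigma_cylinders; apply: (sigma_ind (Q := Q)) => {B}.
- exact: setI_closed_cylinders.
- move=> _ [A sA <-]; split; first exact: path_sigma_cylinder.
  exact: cyl.
- split; first exact: (@measurableT _ (g_sigma_algebraType _)).
  by rewrite !probability_setT.
- move=> B [mB eqB].
  split; first exact: (@measurableC _ (g_sigma_algebraType _)).
  rewrite (probability_setC mu1 (measurable_path_event mX1 mB)).
  by rewrite (probability_setC mu2 (measurable_path_event mX2 mB)) eqB.
- move=> F tF QF; split.
    apply: (@bigcupT_measurable _ (g_sigma_algebraType _)) => n.
    by case: (QF n).
  have lawU (d' : measure_display) (W' : measurableType d')
      (mu : probability W' R) (V : nat -> W' -> S) :
      (forall n, measurable_fun setT (V n)) ->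
      mu [set w | (\bigcup_n F n) (V ^~ w)] =
      (\sum_(n <oo) mu [set w | F n (V ^~ w)])%E.
    move=> mV.
    rewrite path_event_bigcup.
    have mF n : measurable [set w | F n (V ^~ w)].
      exact: (measurable_path_event mV (QF n).1).
    apply: measure_semi_bigcup => //; last exact: bigcupT_measurable.
    exact: trivIset_path_event.
  rewrite (lawU _ _ _ _ mX1) (lawU _ _ _ _ mX2).
  by apply: eq_eseriesr => n _; exact: (QF n).2.
Qed.

(** Decomposition according to the last index n for which a point is in [G n].
    Both the values of T and the last record of a path arise in this way. *)
Lemma measure_layers (R : realType) (d : measure_display) (W : measurableType d)
    (mu : {measure set W -> \bar R}) (G : nat -> set W) (B : set W) :
  measurable B -> (forall n, measurable (G n)) -> G 0%N = setT ->
  (forall n, G n.+1 `<=` G n) ->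
  mu B = (mu (B `&` \bigcap_n G n) +
    \sum_(n <oo) mu (B `&` (G n `\` G n.+1)))%E.
Proof.
move=> mB mG G0 GS; have mGI : measurable (\bigcap_n G n) by exact: bigcapT_measurable.
have Gle m n : (m <= n)%N -> G n `<=` G m.
  by move=> /subnK <-; elim: (n - m)%N => // k IH; apply: subset_trans IH; exact: GS.
rewrite (measureDI mu mB mGI) addeC; congr (_ + _)%E.
rewrite -measure_semi_bigcup.
- congr (mu _); apply/seteqP; split => [w [Bw nG]|w [n _ [Bw [_ nG]]]]; last first.
    by split => // GI; apply: nG; exact: GI.
  have : exists n, ~~ `[< G n w >].
    by apply: contrapT => noG; apply: nG => n _; apply: contrapT => nGn;
      apply: noG; exists n; apply/asboolPn.
  move=> /ex_minnP[[|n] /asboolPn nGn nmin]; first by case: nGn; rewrite G0.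
  exists n => //; split => //; split => //; apply: contrapT => /asboolPn /nmin.
  by rewrite ltnn.
- by move=> n; apply: measurableI => //; exact: measurableD.
- apply/trivIsetP => i j _ _; rewrite neq_ltn => /orP[] ij;
    apply/seteqP; split => // w [[_ [Gi nGi]] [_ [Gj nGj]]].
  + by apply: nGi; exact: Gle Gj.
  + by apply: nGj; exact: Gle Gi.
- apply: bigcupT_measurable => n; apply: measurableI => //; exact: measurableD.
Qed.

Lemma measure_setI_full (R : realType) (d : measure_display)
    (W : measurableType d) (mu : {measure set W -> \bar R}) (A E : set W) :
  measurable A -> measurable E -> mu (~` E) = 0%E -> mu A = mu (A `&` E).
Proof.
move=> mA mE E0; have AE0 : mu (A `\` E) = 0%E.
  apply: (subset_measure0 _ _ _ E0); [exact: measurableD|exact: measurableC|].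
  by move=> w [].
rewrite -[RHS]add0e; etransitivity; first exact: (measureDI mu mA mE).
by congr (_ + _)%E; exact: AE0.
Qed.

(** * The conditioned chain *)

Section conditioned_chain.
Context (R : realType) (d : measure_display) (S : measurableType d).
Variables (P : R.-pker S ~> S) (h : S -> R) (mh : measurable_fun setT h).
Context (d0 : measure_display) (W0 : measurableType d0).
Variables (X : nat -> W0 -> S) (Px : S -> probability W0 R).
Hypothesis hX : forall x, markov_chain (Px x) P x X.
Local Open Scope ereal_scope.

Let mX n : measurable_fun setT (X n). Proof. by case: (hX point). Qed.
Let Q := path_law X Px.

(** Almost surely h (X_0) = h x, hence staying below the level h x, an event that
    varies with x, can be replaced by the path event of staying below the initial
    value.  This makes conditional probabilities measurable in x. *)
Lemma stay_level_law x (C : set (nat -> S)) : path_measurable C ->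
  Px x ([set v | C (X ^~ v)] `&` [set v | forall i, (h (X i v) <= h x)%R]) =
  Q x (C `&` stay_below h).
Proof.
move=> mC.
pose E := X 0%N @^-1` (h @^-1` [set h x]).
have mhE : measurable (h @^-1` [set h x]).
  by rewrite -[X in measurable X]setTI; exact: mh.
have mE : measurable E by rewrite -[X in measurable X]setTI; exact: mX.
have E0 : Px x (~` E) = 0.
  rewrite probability_setC//; case: (hX x) => _ -> // _.
  by rewrite diracE mem_set// subee.
have mstay : measurable [set v | forall i, (h (X i v) <= h x)%R].
  have -> : [set v | forall i, (h (X i v) <= h x)%R] =
      \bigcap_i [set v | (h (X i v) <= h x)%R].
    by apply/seteqP; split => [v sv i _|v sv i]; exact: sv.
  apply: bigcapT_measurable => i; rewrite -[X in measurable X]setTI.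
  by apply: measurable_fun_le => //; exact: measurableT_comp.
have mCX := measurable_path_event mX mC.
have mCS : path_measurable (C `&` stay_below h).
  apply: (@measurableI _ (g_sigma_algebraType _)) => //.
  exact: path_measurable_stay_below.
rewrite /Q /path_law (measure_setI_full _ mE E0); last exact: measurableI.
rewrite [RHS](measure_setI_full (measurable_path_event mX mCS) mE E0).
congr (Px x _); apply/seteqP; split => v [[Cv sv] Ev]; split => //; split => //.
- by move=> i; rewrite Ev; exact: sv.
- by move=> i; rewrite -Ev; exact: sv.
Qed.

Let mS : path_measurable (stay_below h).
Proof. exact: path_measurable_stay_below. Qed.

Let mCS C : path_measurable C -> path_measurable (C `&` stay_below h).
Proof. by move=> mC; exact: (@measurableI _ (g_sigma_algebraType _)). Qed.

Let finQ x C : path_measurable C -> Q x C \is a fin_num.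
Proof.
move=> mC; apply: fin_num_measure; exact: (measurable_path_event mX mC).
Qed.

Let leQS x C : path_measurable C ->
  (0 <= fine (Q x (C `&` stay_below h)) <= fine (Q x (stay_below h)))%R.
Proof.
move=> mC; rewrite fine_ge0//=; apply: (fine_le (finQ x (mCS mC)) (finQ x mS)).
apply: le_measure; rewrite ?inE; [exact: (measurable_path_event mX (mCS mC))|
  exact: (measurable_path_event mX mS)|by move=> v []].
Qed.

Lemma cond_stay_law x (C : set (nat -> S)) : path_measurable C ->
  cond_stay (Px x) X h (h x) C =
  (fine (Q x (C `&` stay_below h)) / fine (Q x (stay_below h)))%:E.
Proof.
move=> mC; rewrite /cond_stay (stay_level_law x mC).
have -> : [set v | forall i, (h (X i v) <= h x)%R] =
    [set v | setT (X ^~ v)] `&` [set v | forall i, (h (X i v) <= h x)%R].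
  by rewrite setTI.
rewrite stay_level_law ?setTI; last exact: (@measurableT _ (g_sigma_algebraType _)).
have /andP[] := leQS x mC.
rewrite -(fineK (finQ x (mCS mC))) -(fineK (finQ x mS)) /=.
set a := fine (Q x (C `&` _)); set b := fine _; move=> a0 ab; rewrite inver.
(* If the conditioning event is null, both sides are 0: the numerator is 0. *)
case: eqP => [b0|_]; last by rewrite EFinM.
have -> : a = 0%R by apply/eqP; rewrite eq_le a0 andbT -b0.
by rewrite mul0e mul0r.
Qed.

Lemma measurable_path_law (C : set (nat -> S)) : path_measurable C ->
  measurable_fun setT (fun x => fine (Q x C)).
Proof.
move=> mC; apply: measurableT_comp => //.
exact: (markov_property_path hX mC).1.
Qed.

Lemma cond_stay_mfun (C : set (nat -> S)) : path_measurable C ->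
  ge0_mfun (fun x => cond_stay (Px x) X h (h x) C).
Proof.
move=> mC; split => [|x]; last first.
  by rewrite cond_stay_law// lee_fin divr_ge0// fine_ge0.
under eq_fun do rewrite cond_stay_law//.
apply/measurable_EFinP; apply: measurable_funM; first exact: measurable_path_law (mCS mC).
apply: measurable_funV_ge0; first exact: measurable_path_law mS.
by move=> x; exact: fine_ge0.
Qed.

(** This also holds when the conditioning event is null, so that the Markov
    property can be used without separating that case. *)
Lemma cond_stay_mul x (C : set (nat -> S)) : path_measurable C ->
  (fine (Q x (stay_below h)))%:E * cond_stay (Px x) X h (h x) C =
  Q x (C `&` stay_below h).
Proof.
move=> mC; rewrite cond_stay_law// -EFinM -[RHS](fineK (finQ x (mCS mC))).
have /andP[] := leQS x mC.
set a := fine (Q x (C `&` _)); set b := fine _; move=> a0 ab; congr EFin.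
have [b0|b0] := eqVneq b 0%R; last by rewrite mulrCA divff// mulr1.
by apply/esym/eqP; rewrite b0 mul0r eq_le a0 andbT -b0.
Qed.

End conditioned_chain.

(** * Splicing at the last record *)

Lemma time_nat (R : realType) n : time (n%:R%:E : \bar R) = n.
Proof. by rewrite /time /= natrK. Qed.

Section splice.
Context (R : realType) (S : Type) (p q : nat -> S).

Lemma splice_infty : splice (+oo : \bar R)%E p q = p.
Proof. by apply/funext => n; rewrite /splice ltry. Qed.

Lemma splice_lt n k : (k < n)%N -> splice (n%:R%:E : \bar R) p q k = p k.
Proof. by move=> kn; rewrite /splice lte_fin ltr_nat kn. Qed.

Lemma splice_ge n k : splice (n%:R%:E : \bar R) p q (n + k)%N = q k.
Proof.
by rewrite /splice lte_fin ltr_nat ltnNge leq_addr/= time_nat addKn.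
Qed.

End splice.

Section spliced_chain.
Context (R : realType) (d : measure_display) (S : measurableType d).
Variables (P : R.-pker S ~> S) (h : S -> R) (hP : is_harmonic P h).
Variables (o : S) (ho : 0 < h o).
Context (d0 : measure_display) (W0 : measurableType d0).
Variables (X : nat -> W0 -> S) (Px : S -> probability W0 R)
  (hX : forall x, markov_chain (Px x) P x X).
Context (d1 : measure_display) (W : measurableType d1) (PP : probability W R).
Variables (Xhat : nat -> W -> posset ho)
  (hXhat : markov_chain PP (htransform hP ho) (pospt ho) Xhat).
Variables (Y : W -> R) (mY : measurable_fun [set: W] Y)
  (Yrange : forall w, h o < Y w)
  (Ylaw : forall y, h o <= y -> PP [set w | y < Y w] = (h o / y)%:E)
  (Yindep : independent_systems PP (sigma_process [set: nat] Xhat)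
     (preimage_set_system [set: W] Y measurable)).
Variables (T : W -> \bar R)
  (hT : forall w, T w = last_record (fun n => h (posval (Xhat n w))) (Y w)).
Variables (XT : W -> S) (hXT : forall w, XT w = posval (Xhat (time (T w)) w)).
Variables (Xcheck : nat -> W -> S)
  (mXcheck : forall n, measurable_fun [set w | (T w < +oo)%E] (Xcheck n))
  (Xcheck0 : forall w, (T w < +oo)%E -> Xcheck 0%N w = XT w)
  (Xchecklaw : conditional_law_on PP
     <<s sigma_process [set: nat] Xhat `|`
         preimage_set_system [set: W] Y measurable >>
     [set w | (T w < +oo)%E] Xcheck
     (fun w => cond_stay (Px (XT w)) X h (h (XT w)))).
Variables (Xbar : nat -> W -> S)
  (hXbar : forall n w, Xbar n w =
     splice (T w) (fun k => posval (Xhat k w)) (fun k => Xcheck k w) n).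

Let Z n w := posval (Xhat n w).
Let past m := [set i | (i <= m)%N].

Let mh : measurable_fun setT h. Proof. by case: hP. Qed.
Let mX n : measurable_fun setT (X n). Proof. by case: (hX o). Qed.
Let mZ n : measurable_fun setT (Z n). Proof. exact: (measurable_hchain hXhat). Qed.
Let TE : T = fun w => last_record (fun n => h (Z n w)) (Y w).
Proof. exact/funext. Qed.
Let infoT n := sigma_last_record_eq (Xhat := Xhat) (Y := Y) hP n.

Let mTge n : measurable [set w | (n%:R%:E <= T w)%E].
Proof.
by rewrite TE; exact: (measurable_information hXhat mY (sigma_last_record_ge hP n)).
Qed.

Let mTeq n : measurable [set w | T w = n%:R%:E].
Proof. by rewrite TE; exact: (measurable_information hXhat mY (infoT n)). Qed.

Let mTfin : measurable [set w | (T w < +oo)%E].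
Proof.
have -> : [set w | (T w < +oo)%E] = \bigcup_n [set w | T w = n%:R%:E].
  apply/seteqP; split => [w|w [n _ /= ->]]; last exact: ltry.
  by rewrite /= hT => /last_record_finP[n Tn]; exists n => //=; rewrite hT.
exact: bigcupT_measurable.
Qed.

Let mTinf : measurable [set w | T w = +oo%E].
Proof.
rewrite (_ : [set _ | _] = ~` [set w | (T w < +oo)%E]); first exact: measurableC.
apply/seteqP; split => w /=; first by move=> ->; rewrite ltxx.
by move=> /negP; rewrite -leNgt leye_eq => /eqP.
Qed.

Let Xbar_inf w : T w = +oo%E -> Xbar ^~ w = Z ^~ w.
Proof.
by move=> Tw; apply/funext => k; rewrite hXbar Tw splice_infty.
Qed.

Let Xbar_ge w n k : T w = n%:R%:E -> Xbar (n + k)%N w = Xcheck k w.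
Proof.
by move=> Tw; rewrite hXbar Tw splice_ge.
Qed.

(** At time T itself the two pieces agree, as Xcheck starts in Xhat at time T. *)
Let Xbar_le w n k : T w = n%:R%:E -> (k <= n)%N -> Xbar k w = Z k w.
Proof.
move=> Tw; rewrite leq_eqVlt => /predU1P[->|kn].
  rewrite -[n in Xbar n]addn0 (Xbar_ge _ Tw) Xcheck0 ?Tw ?ltry//.
  by rewrite hXT Tw time_nat.
by rewrite hXbar Tw splice_lt.
Qed.

Lemma measurable_spliced n : measurable_fun setT (Xbar n).
Proof.
move=> _ B mB; rewrite setTI.
have -> : Xbar n @^-1` B =
    ([set w | T w = +oo%E] `&` Z n @^-1` B) `|`
    \bigcup_k ([set w | T w = k%:R%:E] `&`
      (if (n < k)%N then Z n @^-1` B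
       else [set w | (T w < +oo)%E] `&` Xcheck (n - k)%N @^-1` B)).
  apply/seteqP; split => [w /= Bw|w [[Tw Bw]|[k _ [Tw]]]].
  - have [Tw|] := eqVneq (T w) +oo%E.
      by left; split => //=; rewrite -[Z n w]/((Z ^~ w) n) -Xbar_inf.
    rewrite -ltey hT => /last_record_finP[k]; rewrite -hT => Tw; right.
    exists k => //; split => //; case: ltnP => [nk|kn].
      by rewrite /= -(Xbar_le Tw (ltnW nk)).
    by split => /=; [rewrite Tw ltry|rewrite -(Xbar_ge _ Tw) subnKC].
  - by rewrite /= -[Xbar n w]/((Xbar ^~ w) n) Xbar_inf.
  - case: ltnP => [nk|kn] /=; first by rewrite -(Xbar_le Tw (ltnW nk)).
    by case=> _; rewrite -(Xbar_ge _ Tw) subnKC.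
have mZB : measurable (Z n @^-1` B).
  by rewrite -[X in measurable X]setTI; exact: mZ.
apply: measurableU; first exact: measurableI.
apply: bigcupT_measurable => k; apply: measurableI => //.
by case: ifP => // _; exact: mXcheck.
Qed.

Let mSt : path_measurable (stay_below h).
Proof. exact: path_measurable_stay_below. Qed.

Let law_last_record n F : path_sigma (past n) F ->
    (PP ([set w | F (Z ^~ w)] `&` [set w | T w = n%:R%:E]) =
    Px o ([set w | F (X ^~ w)] `&` [set w | record_at h n (X ^~ w)] `&`
       [set w | stay_below h (fun i => X (n + i)%N w)]))%E.
Proof.
rewrite TE.
exact: (last_record_probability (hX o) hXhat mY Yrange Ylaw Yindep).
Qed.

(** Splitting the cylinder at time n, the first part is an event for Z and T and
    the second one is integrated with the conditional law of Xcheck.  By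
    [last_record_probability] and the Markov property, passing from Z on T = n to
    X on the event that n is a record produces the weight Q_y (stay below) at
    y = X_n, which is the denominator of that conditional law. *)
Lemma spliced_finite_part n A : cylinder_sides setT A ->
    (PP ([set w | cylinder A (Xbar ^~ w)] `&` [set w | T w = n%:R%:E]) =
    Px o ([set w | cylinder A (X ^~ w)] `&`
      ([set w | record_at h n (X ^~ w)] `&`
       [set w | stay_below h (fun i => X (n + i)%N w)])))%E.
Proof.
move=> [mA _ [N AN]].
pose A1 i := if (i <= n)%N then A i else setT.
pose A2 i := A (n + i)%N.
have sA1 : cylinder_sides (past n) A1.
  split=> [i|i /= /negP ni|]; rewrite /A1; [by case: ifP|by rewrite (negbTE ni)|].
  by exists N => i Ni; case: ifP => // _; exact: AN.
have sA2 : cylinder_sides setT A2.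
  split=> [i||]; [exact: mA|by move=> i /(_ Logic.I)|exists N => i Ni; apply: AN].
  exact: leq_trans Ni (leq_addl _ _).
have FA1 := path_sigma_cylinder sA1.
have mA2 : path_measurable (cylinder A2) := path_sigma_cylinder sA2.
pose D := [set w | cylinder A1 (Z ^~ w)] `&` [set w | T w = n%:R%:E].
pose C := cylinder A1 `&` record_at h n.
have FC : path_sigma (past n) C.
  apply: (@measurableI _ (g_sigma_algebraType _)) => //.
  exact: path_sigma_record_at.
pose DX := [set w | C (X ^~ w)].
have FDX : sigma_process (past n) X DX := sigma_process_path FC.
have mDX : measurable DX := measurable_path_event mX FC.
have mD : measurable D.
  by apply: measurableI => //; exact: (measurable_path_event mZ FA1).
have -> : [set w | cylinder A (Xbar ^~ w)] `&` [set w | T w = n%:R%:E] =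
    D `&` [set w | (T w < +oo)%E] `&` [set w | cylinder A2 (Xcheck ^~ w)].
  apply/seteqP; split => [w [Aw Tw]|w [[[A1w Tw] _] A2w]].
    split; first split; first split => //.
    - by move=> i; rewrite /A1; case: ifP => // ni;
        rewrite -(Xbar_le Tw ni); exact: Aw.
    - by rewrite /= Tw ltry.
    - by move=> i; rewrite -(Xbar_ge _ Tw); exact: Aw.
  split => // i; have [ni|ni] := leqP i n.
    by have := A1w i; rewrite /A1 ni (Xbar_le Tw ni).
  by have := A2w (i - n)%N; rewrite /A2 -(Xbar_ge _ Tw) subnKC// ltnW.
rewrite Xchecklaw//; last first.
  apply: (@measurableI _ (g_sigma_algebraType _)); last by rewrite TE; exact: infoT.
  apply: sub_sigma_algebra; left; apply: sigma_hchain.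
  exact: sigma_process_path (path_sigma_mono (@subsetT _ _) FA1).
have -> : D `&` [set w | (T w < +oo)%E] = D.
  by apply/seteqP; split => w [] // A1w Tw; split => //=; rewrite Tw ltry.
pose f x := cond_stay (Px x) X h (h x) (cylinder A2).
have mf : ge0_mfun f := cond_stay_mfun mh hX mA2.
transitivity (\int[PP]_(w in D) f (Z n w))%E.
  apply: eq_integral => w; rewrite inE => -[_ Tw].
  by rewrite /f hXT Tw time_nat.
rewrite (@integral_comp_density _ _ _ _ _ _ _ PP (Px o) D DX (Z n) mD mDX (mZ n)
  (X n) (fun w => fine (path_law X Px (X n w) (stay_below h))))//; first last.
- move=> B mB.
  have FB (F : set (nat -> S)) : path_sigma (past n) F ->
      path_sigma (past n) (F `&` [set p | B (p n)]).
    move=> FF; apply: (@measurableI _ (g_sigma_algebraType _)) => //.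
    apply: (@sigma_process_coord _ _ _ (past n) (fun n p => p n)) => //.
    exact: leqnn.
  transitivity (PP ([set w | (cylinder A1 `&` [set p | B (p n)]) (Z ^~ w)] `&`
      [set w | T w = n%:R%:E])).
    by congr (PP _); apply/seteqP; split => w [[]].
  rewrite (law_last_record (FB _ FA1)).
  transitivity (Px o ([set w | (C `&` [set p | B (p n)]) (X ^~ w)] `&`
      [set w | stay_below h (fun i => X (n + i)%N w)])).
    by congr (Px o _); apply/seteqP; split => w [[[]]].
  rewrite ((markov_property_path hX mSt).2 o n _
    (sigma_process_path (X := X) (FB _ FC))).
  apply: eq_integral => w _; rewrite fineK//.
  exact/fin_num_measure/(measurable_path_event mX mSt).
- by move=> w; exact: fine_ge0.
- by apply: (measurableT_comp (measurable_path_law hX mSt)).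
have mA2St : path_measurable (cylinder A2 `&` stay_below h).
  exact: (@measurableI _ (g_sigma_algebraType _)).
under eq_integral do rewrite (cond_stay_mul mh hX)//.
rewrite -((markov_property_path hX mA2St).2 o n _ FDX).
congr (Px o _); apply/seteqP; split => w.
  move=> [[A1w rw] [A2w sw]]; split => // i; have [ni|ni] := leqP i n.
    by have := A1w i; rewrite /A1 ni.
  by have := A2w (i - n)%N; rewrite /A2 subnKC// ltnW.
move=> [Aw [rw sw]]; split; split => //.
  by move=> i; rewrite /A1; case: ifP => // _; exact: Aw.
by move=> i; exact: Aw.
Qed.

(** A cylinder only sees finitely many coordinates, so that
    [infinite_record_probability] applies. *)
Lemma spliced_infinite_part A : cylinder_sides setT A ->
    (PP ([set w | cylinder A (Xbar ^~ w)] `&` [set w | T w = +oo%E]) =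
    Px o ([set w | cylinder A (X ^~ w)] `&`
      [set w | forall m, record_from h m (X ^~ w)]))%E.
Proof.
move=> [mA _ [N AN]].
have sA : cylinder_sides (past N) A.
  by split => //; [move=> i /= /negP; rewrite -ltnNge => /ltnW /AN|exists N].
transitivity (PP ([set w | cylinder A (Z ^~ w)] `&` [set w | T w = +oo%E])).
2: by rewrite TE; exact: (infinite_record_probability (hX o) hXhat mY Yrange
  Ylaw Yindep (path_sigma_cylinder sA)).
congr (PP _); apply/seteqP; split => w /= [Aw Tw]; split => //.
  by rewrite -[fun n => _]/(Z ^~ w) -(Xbar_inf Tw).
by rewrite (Xbar_inf Tw).
Qed.

Lemma spliced_law B : path_measurable B ->
    PP [set w | B (Xbar ^~ w)] = Px o [set v | B (X ^~ v)].
Proof.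
apply: (eq_path_law measurable_spliced mX) => A sA; have FA := path_sigma_cylinder sA.
have mrec m := measurable_path_event mX (@path_measurable_record_from _ _ _ h mh m).
rewrite (measure_layers PP (measurable_path_event measurable_spliced FA) mTge); first last.
- by move=> n w /=; apply: le_trans; rewrite lee_fin ler_nat.
- by apply/seteqP; split => // w _ /=; rewrite hT; apply/last_record_geP; exists 0%N.
rewrite [RHS](measure_layers (Px o) (measurable_path_event mX FA) mrec); first last.
- by move=> n w /= [m nm rm]; exists m => //; exact: ltnW.
- by apply/seteqP; split => // w _; exists 0%N.
congr (_ + _)%E.
  have -> : \bigcap_n [set w | (n%:R%:E <= T w)%E] = [set w | T w = +oo%E].
    apply/seteqP; split => [w Tw|w Tw n _]; last by rewrite /= Tw leey.
    by rewrite /= hT; apply/last_record_inftyP => n; rewrite -hT; exact: Tw.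
  apply: (etrans (spliced_infinite_part sA)); congr (Px o (_ `&` _)).
  by apply/seteqP; split => w rw n *; exact: rw.
apply: eq_eseriesr => n _.
have -> : [set w | (n%:R%:E <= T w)%E] `\` [set w | (n.+1%:R%:E <= T w)%E] =
    [set w | T w = n%:R%:E].
  by apply/seteqP; split => w /=; rewrite hT => /last_record_eqP.
apply: (etrans (spliced_finite_part n sA)); congr (Px o (_ `&` _)).
have /seteqP[s1 s2] := @last_recordE _ _ _ h n.
by apply/seteqP; split => w; [exact: s2|exact: s1].
Qed.

End spliced_chain.

Theorem theorem2 (R : realType)
  (d : measure_display) (S : measurableType d) (P : R.-pker S ~> S)
  (h : S -> R) (hP : is_harmonic P h) (o : S) (ho : 0 < h o)
  (* the Markov chain X with kernel P under the measures P_x *)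
  (d0 : measure_display) (W0 : measurableType d0)
  (X : nat -> W0 -> S) (Px : S -> probability W0 R)
  (hX : forall x, markov_chain (Px x) P x X)
  (* the probability space carrying Xhat, Y and Xcheck *)
  (d1 : measure_display) (W : measurableType d1) (PP : probability W R)
  (Xhat : nat -> W -> posset ho)
  (hXhat : markov_chain PP (htransform hP ho) (pospt ho) Xhat)
  (Y : W -> R) (mY : measurable_fun [set: W] Y)
  (Yrange : forall w, h o < Y w)
  (Ylaw : forall y, h o <= y -> PP [set w | y < Y w] = (h o / y)%:E)
  (Yindep : independent_systems PP (sigma_process [set: nat] Xhat)
     (preimage_set_system [set: W] Y measurable))
  (T : W -> \bar R)
  (hT : forall w, T w = last_record (fun n => h (posval (Xhat n w))) (Y w))
  (XT : W -> S) (hXT : forall w, XT w = posval (Xhat (time (T w)) w))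
  (Xcheck : nat -> W -> S)
  (mXcheck : forall n, measurable_fun [set w | (T w < +oo)%E] (Xcheck n))
  (Xcheck0 : forall w, (T w < +oo)%E -> Xcheck 0%N w = XT w)
  (Xchecklaw : conditional_law_on PP
     <<s sigma_process [set: nat] Xhat `|`
         preimage_set_system [set: W] Y measurable >>
     [set w | (T w < +oo)%E] Xcheck
     (fun w => cond_stay (Px (XT w)) X h (h (XT w))))
  (Xbar : nat -> W -> S)
  (hXbar : forall n w, Xbar n w =
     splice (T w) (fun k => posval (Xhat k w)) (fun k => Xcheck k w) n) :
  markov_chain PP P o Xbar /\
  (forall B, path_measurable B ->
     PP [set w | B (fun n => Xbar n w)] = Px o [set v | B (fun n => X n v)]).
Proof.
have mX n : measurable_fun setT (X n) by case: (hX o).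
have mXbar n : measurable_fun setT (Xbar n).
  exact: (measurable_spliced hXhat mY hT hXT mXcheck Xcheck0 hXbar).
have law B : path_measurable B ->
    PP [set w | B (Xbar ^~ w)] = Px o [set v | B (X ^~ v)].
  exact: (spliced_law hX hXhat mY Yrange Ylaw Yindep hT hXT mXcheck Xcheck0
    Xchecklaw hXbar).
(* Both sides of the Markov property are determined by the law of the process. *)
split => //; split => //.
  move=> A mA; have [_ X0 _] := hX o; rewrite -X0//.
  apply: (law [set p | A (p 0%N)]).
  exact: (@sigma_process_coord _ _ _ setT (fun n p => p n)).
move=> n D A; rewrite sigma_processE => -[C FC <-] mA; rewrite setTI.
have FT : path_measurable C.
  exact: (path_sigma_mono (@subsetT _ _) FC).
have FB k B : measurable B -> path_measurable (C `&` [set p | B (p k)]).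
  move=> mB; apply: (@measurableI _ (g_sigma_algebraType _)) => //.
  exact: (@sigma_process_coord _ _ _ setT (fun n p => p n)).
have [_ _ stepX] := hX o.
transitivity (Px o ([set w | C (X ^~ w)] `&` X n.+1 @^-1` A)).
  exact: (law _ (FB n.+1 A mA)).
rewrite stepX//; last exact: sigma_process_path.
have mkP : ge0_mfun (fun x => P x A).
  by split => //; exact: measurable_kernel.
rewrite (@integral_comp_density _ _ _ _ _ _ _ (Px o) PP [set w | C (X ^~ w)]
  [set w | C (Xbar ^~ w)] (X n) (measurable_path_event mX FT)
  (measurable_path_event mXbar FT) (mX n) (Xbar n) (cst 1) _ _ _ _ _ mkP)//.
  by apply: eq_integral => w _; rewrite mul1e.
move=> B mB; rewrite [RHS](_ : _ =
  \int[PP]_(w in [set w | C (Xbar ^~ w)] `&` Xbar n @^-1` B) cst 1%E w)%E//.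
rewrite integral_cst ?mul1e; first exact/esym/(law _ (FB n B mB)).
exact: (measurable_path_event mXbar (FB n B mB)).
Qed.
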